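(* The Kodaira-Thurston surface $M$ admits both a holomorphic symplectic structure and a generalized hypercomplex structure in which all the generalized complex structures in the generalized hypercomplex $S^2$-family are of type $1$.
   Context: The Kodaira-Thurston surface is the compact $4$-manifold $\Gamma\backslash(H_3\times\mathbb R)$, where $H_3$ is the real $3$-dimensional Heisenberg Lie group and $\Gamma$ is a lattice; $H_3\times\mathbb R$ has a left-invariant coframe $e^0,e^1,e^2,e^3$ with $de^0=de^1=de^2=0$, $de^3=-e^1\wedge e^2$. A holomorphic symplectic structure on $M$ is a complex structure together with a closed non-degenerate $(2,0)$-form. On $TM\oplus T^*M$ consider the pairing $\langle X+\xi,Y+\eta\rangle=\frac12(\xi(Y)+\eta(X))$ and the Courant bracket $[X+\xi,Y+\eta]=[X,Y]+L_X\eta-L_Y\xi-\frac12 d(i_X\eta-i_Y\xi)$. A generalized complex structure on $M$ is an endomorphism $\mathcal I$ of $TM\oplus T^*M$, orthogonal for the pairing, with $\mathcal I^2=-\mathrm{Id}$ and with $\sqrt{-1}$-eigenbundle $L$ closed under the Courant bracket. At each point, $L$ is the annihilator (under $(X+\xi)\cdot\rho=i_X\rho+\xi\wedge\rho$) of a complex form $\rho=e^{B+i\omega}\Omega$ with $B,\omega$ real $2$-forms and $\Omega$ decomposable; the type at that point is $\deg\Omega$. A generalized hypercomplex structure is a triple of pairwise anti-commuting generalized complex structures $(\mathcal I,\mathcal J,\mathcal K=\mathcal I\mathcal J)$ for which all members $a\mathcal I+b\mathcal J+c\mathcal K$, $a^2+b^2+c^2=1$, of the $S^2$-family are generalized complex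 structures. *)

(* Defs.v *)
From HB Require Import structures.
From mathcomp Require Import all_boot all_order all_algebra.
From mathcomp Require Import all_classical all_reals all_analysis.
From mathcomp Require Import complex.

Set Implicit Arguments.
Unset Strict Implicit.
Unset Printing Implicit Defensive.

Import Order.TTheory GRing.Theory Num.Theory.
Import numFieldNormedType.Exports.

Local Open Scope classical_set_scope.
Local Open Scope complex_scope.
Local Open Scope ring_scope.

(* Vectors and covectors at a point of R^n are columns, a bilinear form b is
   the matrix with b(u, v) = u^T b v, and an endomorphism A sends u to
   A *m u. *)

Section Calculus.
Context {R : realType} {n : nat}.

Definition partial (j : 'I_n) (f : 'cV[R]_n -> R) (p : 'cV[R]_n) : R :=
  'D_(delta_mx j 0) f p.

Fixpoint Cdiff (k : nat) (U : set 'cV[R]_n) (f : 'cV[R]_n -> R) : Prop :=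
  if k is k'.+1 then
    (forall p, U p -> differentiable f p) /\
    (forall j, Cdiff k' U (partial j f))
  else forall p, U p -> {for p, continuous f}.

Definition smooth (U : set 'cV[R]_n) (f : 'cV[R]_n -> R) : Prop :=
  forall k, Cdiff k U f.

Definition smooth_mx (U : set 'cV[R]_n) (k l : nat)
    (F : 'cV[R]_n -> 'M[R]_(k, l)) : Prop :=
  forall i j, smooth U (fun p => F p i j).

Definition jac (m : nat) (f : 'cV[R]_n -> 'cV[R]_m) (p : 'cV[R]_n) :
  'M[R]_(m, n) := \matrix_(i, j) partial j (fun q => f q i 0) p.

Definition cpartial (j : 'I_n) (f : 'cV[R]_n -> R[i]) (p : 'cV[R]_n) : R[i] :=
  partial j (fun q => complex.Re (f q)) p
  +i* partial j (fun q => complex.Im (f q)) p.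

Definition csmooth_mx (U : set 'cV[R]_n) (k l : nat)
    (F : 'cV[R]_n -> 'M[R[i]]_(k, l)) : Prop :=
  forall i j, smooth U (fun p => complex.Re (F p i j)) /\
              smooth U (fun p => complex.Im (F p i j)).

End Calculus.

Section GeneralizedTangentBundle.
Context {R : realType} {n : nat}.

(* An element X + xi of (TM + T^*M)_p is the column col_mx X xi. *)

Definition pairing (u v : 'cV[R]_(n + n)) : R :=
  2^-1 * \sum_i (dsubmx u i 0 * usubmx v i 0 + dsubmx v i 0 * usubmx u i 0).

Definition contract (X xi : 'cV[R]_n -> 'cV[R[i]]_n) (p : 'cV[R]_n) : R[i] :=
  \sum_i X p i 0 * xi p i 0.

Definition differential (f : 'cV[R]_n -> R[i]) (p : 'cV[R]_n) : 'cV[R[i]]_n :=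
  \col_j cpartial j f p.

Definition lie_bracket (X Y : 'cV[R]_n -> 'cV[R[i]]_n) (p : 'cV[R]_n) :
    'cV[R[i]]_n :=
  \col_j \sum_i (X p i 0 * cpartial i (fun q => Y q j 0) p
                 - Y p i 0 * cpartial i (fun q => X q j 0) p).

Definition lie_derivative (X xi : 'cV[R]_n -> 'cV[R[i]]_n) (p : 'cV[R]_n) :
    'cV[R[i]]_n :=
  \col_j \sum_i (X p i 0 * cpartial i (fun q => xi q j 0) p
                 + xi p i 0 * cpartial j (fun q => X q i 0) p).

Definition courant (s t : 'cV[R]_n -> 'cV[R[i]]_(n + n)) (p : 'cV[R]_n) :
    'cV[R[i]]_(n + n) :=
  let X q := usubmx (s q) in let xi q := dsubmx (s q) in
  let Y q := usubmx (t q) in let eta q := dsubmx (t q) in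
  col_mx (lie_bracket X Y p)
    (lie_derivative X eta p - lie_derivative Y xi p
     - 2^-1 *: differential (fun q => contract X eta q - contract Y xi q) p).

Definition cmx (k l : nat) (A : 'M[R]_(k, l)) : 'M[R[i]]_(k, l) :=
  map_mx (real_complex R) A.

Definition eigenL (A : 'M[R]_(n + n)) (u : 'cV[R[i]]_(n + n)) : Prop :=
  cmx A *m u = 'i%C *: u.

Definition courant_integrable (A : 'cV[R]_n -> 'M[R]_(n + n)) : Prop :=
  forall (U : set 'cV[R]_n) (s t : 'cV[R]_n -> 'cV[R[i]]_(n + n)),
    open U -> csmooth_mx U s -> csmooth_mx U t ->
    (forall p, U p -> eigenL (A p) (s p)) ->
    (forall p, U p -> eigenL (A p) (t p)) ->
    forall p, U p -> eigenL (A p) (courant s t p).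

End GeneralizedTangentBundle.

Section Type_.
Context {R : realType} {n : nat}.

(* The exterior algebra of C^n: the coordinate of a form at
   {i_1 < ... < i_k} is its coefficient on dx_{i_1} /\ ... /\ dx_{i_k}. *)
Definition form : Type := {ffun {set 'I_n} -> R[i]}.

(* dx_S /\ dx_T = shuffle_sign S T dx_(S :|: T) for disjoint S and T. *)
Definition shuffle_sign (S T : {set 'I_n}) : R[i] :=
  (-1) ^+ #|[set ij : 'I_n * 'I_n |
             [&& ij.1 \in S, ij.2 \in T & (ij.2 < ij.1)%N]]|.

Definition wedge (a b : form) : form :=
  [ffun A : {set 'I_n} => \sum_(S : {set 'I_n} | S \subset A)
     shuffle_sign S (A :\: S) * a S * b (A :\: S)].

Definition form_one : form := [ffun A : {set 'I_n} => (A == finset.set0)%:R].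

Definition form1 (xi : 'cV[R[i]]_n) : form :=
  [ffun A : {set 'I_n} => \sum_(i | A == [set i]%SET) xi i 0].

(* The 2-form with matrix b, that is, the sum over i < j of
   b_ij dx_i /\ dx_j. *)
Definition form2 (b : 'M[R[i]]_n) : form :=
  [ffun A : {set 'I_n} =>
     \sum_(ij : 'I_n * 'I_n | (ij.1 < ij.2)%N && (A == [set ij.1; ij.2]%SET))
       b ij.1 ij.2].

Definition interior (X : 'cV[R[i]]_n) (a : form) : form :=
  [ffun A : {set 'I_n} => \sum_(i | i \notin A)
     shuffle_sign [set i]%SET A * X i 0 * a (i |: A)%SET].

Definition clifford (u : 'cV[R[i]]_(n + n)) (rho : form) : form :=
  interior (usubmx u) rho + wedge (form1 (dsubmx u)) rho.

(* Only used for b of degree 2, where the k-th power vanishes for 2k > n. *)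
Definition form_exp (b : form) : form :=
  \sum_(k < n.+1) (k`!%:R)^-1 *: iter k (wedge b) form_one.

Definition decomposable (k : nat) (Omega : form) : Prop :=
  Omega != 0 /\
  exists (c : R[i]) (theta : 'I_k -> 'cV[R[i]]_n),
    Omega = c *: \big[wedge/form_one]_(j < k) form1 (theta j).

Definition alternating (K : comPzRingType) (b : 'M[K]_n) : Prop :=
  b^T = - b /\ forall i, b i i = 0.

Definition has_type (A : 'M[R]_(n + n)) (k : nat) : Prop :=
  exists (B omega : 'M[R]_n) (Omega : form),
    [/\ alternating B, alternating omega, decomposable k Omega &
     forall u : 'cV[R[i]]_(n + n),
       eigenL A u <->
       clifford u (wedge (form_exp (form2 (cmx B + 'i%C *: cmx omega))) Omega)
         = 0].

End Type_.

Section ComplexStructures.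
Context {R : realType} {m : nat}.
Local Notation n := (m + m)%N.

(* Multiplication by i on C^m = R^m + i R^m. *)
Definition std_complex : 'M[R]_n := block_mx 0 (- 1%:M) 1%:M 0.

Definition holomorphic_chart (J : 'cV[R]_n -> 'M[R]_n)
    (U : set 'cV[R]_n) (phi : 'cV[R]_n -> 'cV[R]_n) : Prop :=
  exists (V : set 'cV[R]_n) (psi : 'cV[R]_n -> 'cV[R]_n),
    [/\ open U, open V, smooth_mx U phi & smooth_mx V psi] /\
    [/\ forall p, U p -> V (phi p),
        forall q, V q -> U (psi q),
        forall p, U p -> psi (phi p) = p,
        forall q, V q -> phi (psi q) = q &
        forall p, U p -> jac phi p *m J p = std_complex *m jac phi p].

Definition complex_structure (J : 'cV[R]_n -> 'M[R]_n) : Prop :=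
  [/\ smooth_mx setT J,
      forall p, J p *m J p = - 1%:M &
      forall p, exists U phi, U p /\ holomorphic_chart J U phi].

Definition closed2 (s : 'cV[R]_n -> 'M[R[i]]_n) : Prop :=
  forall p i j k,
    cpartial i (fun q => s q j k) p + cpartial j (fun q => s q k i) p
    + cpartial k (fun q => s q i j) p = 0.

Definition holomorphic_symplectic (J : 'cV[R]_n -> 'M[R]_n)
    (s : 'cV[R]_n -> 'M[R[i]]_n) : Prop :=
  [/\ complex_structure J,
      csmooth_mx setT s /\ (forall p, alternating (s p)),
      (* (2,0)-form: zero as soon as one argument is of type (0,1) *)
      forall p (u : 'cV[R[i]]_n), cmx (J p) *m u = - 'i%C *: u ->
        forall v : 'cV[R[i]]_n, u^T *m s p *m v = 0,
      closed2 s &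
      (* non-degeneracy on the vectors of type (1,0) *)
      forall p (u : 'cV[R[i]]_n), cmx (J p) *m u = 'i%C *: u ->
        (forall v : 'cV[R[i]]_n, cmx (J p) *m v = 'i%C *: v ->
           u^T *m s p *m v = 0) ->
        u = 0].

End ComplexStructures.

Section KodairaThurston.
Context {R : realType}.

(* H_3 x R on R^4 with coordinates (x_0, x_1, x_2, x_3): x_0 is the
   coordinate of R and (x_1, x_2, x_3) stands for the unipotent matrix
   [[1, x_1, x_3], [0, 1, x_2], [0, 0, 1]].  The left-invariant coframe is
   e^0 = dx_0, e^1 = dx_1, e^2 = dx_2, e^3 = dx_3 - x_1 dx_2, so that
   de^3 = - e^1 /\ e^2. *)
Definition kt_mul (x y : 'cV[R]_4) : 'cV[R]_4 :=
  \col_(i < 4) (x i 0 + y i 0 + (if i == 3 then x 1 0 * y 2 0 else 0)).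

Definition kt_inv (x : 'cV[R]_4) : 'cV[R]_4 :=
  \col_(i < 4) (- x i 0 + (if i == 3 then x 1 0 * x 2 0 else 0)).

(* The Kodaira-Thurston surface M is the quotient of R^4 by the left
   translations of such a Gam.  R^4 -> M is a local diffeomorphism, and tensor
   fields on M are represented by their pullbacks to R^4, which are the
   Gam-invariant tensor fields on R^4. *)
Definition lattice (Gam : set 'cV[R]_4) : Prop :=
  [/\ Gam 0,
      forall x y, Gam x -> Gam y -> Gam (kt_mul x y),
      forall x, Gam x -> Gam (kt_inv x),
      \forall x \near (0 : 'cV[R]_4), Gam x -> x = 0 &
      exists2 D : set 'cV[R]_4, compact D &
        forall x, exists g d, [/\ Gam g, D d & x = kt_mul g d]].

Definition invariant_endo (Gam : set 'cV[R]_4) (J : 'cV[R]_4 -> 'M[R]_4) :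
    Prop :=
  forall g p, Gam g ->
    J (kt_mul g p) *m jac (kt_mul g) p = jac (kt_mul g) p *m J p.

Definition invariant_form2 (Gam : set 'cV[R]_4) (s : 'cV[R]_4 -> 'M[R[i]]_4) :
    Prop :=
  forall g p, Gam g ->
    (cmx (jac (kt_mul g) p))^T *m s (kt_mul g p) *m cmx (jac (kt_mul g) p)
    = s p.

(* The action on TM + T^*M of a diffeomorphism with Jacobian matrix D. *)
Definition gpush (D : 'M[R]_4) : 'M[R]_(4 + 4) :=
  block_mx D 0 0 (invmx D)^T.

Definition invariant_gendo (Gam : set 'cV[R]_4)
    (A : 'cV[R]_4 -> 'M[R]_(4 + 4)) : Prop :=
  forall g p, Gam g ->
    A (kt_mul g p) *m gpush (jac (kt_mul g) p)
    = gpush (jac (kt_mul g) p) *m A p.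

Definition KT_holomorphic_symplectic (Gam : set 'cV[R]_4)
    (J : 'cV[R]_4 -> 'M[R]_4) (s : 'cV[R]_4 -> 'M[R[i]]_4) : Prop :=
  [/\ invariant_endo Gam J, invariant_form2 Gam s &
      @holomorphic_symplectic R 2 J s].

Definition KT_gcs (Gam : set 'cV[R]_4) (A : 'cV[R]_4 -> 'M[R]_(4 + 4)) :
    Prop :=
  [/\ smooth_mx setT A, invariant_gendo Gam A,
      forall p u v, pairing (A p *m u) (A p *m v) = pairing u v,
      forall p, A p *m A p = - 1%:M &
      courant_integrable A].

Definition sphere_member (I J K : 'cV[R]_4 -> 'M[R]_(4 + 4)) (a b c : R)
    (p : 'cV[R]_4) : 'M[R]_(4 + 4) :=
  a *: I p + b *: J p + c *: K p.

Definition KT_generalized_hypercomplex (Gam : set 'cV[R]_4)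
    (I J K : 'cV[R]_4 -> 'M[R]_(4 + 4)) : Prop :=
  [/\ KT_gcs Gam I /\ KT_gcs Gam J /\ KT_gcs Gam K,
      (forall p, I p *m J p = - (J p *m I p)) /\
      (forall p, I p *m K p = - (K p *m I p)) /\
      (forall p, J p *m K p = - (K p *m J p)),
      forall p, K p = I p *m J p &
      forall a b c : R, a ^+ 2 + b ^+ 2 + c ^+ 2 = 1 ->
        KT_gcs Gam (sphere_member I J K a b c)].

End KodairaThurston.

(* Main.v *)
Require Import Defs.
From HB Require Import structures.
From mathcomp Require Import all_boot all_order all_algebra.
From mathcomp Require Import all_classical all_reals all_analysis.
From mathcomp Require Import complex.
From mathcomp Require Import ring.
Import Order.TTheory GRing.Theory Num.Theory.
Import numFieldNormedType.Exports.
Local Open Scope classical_set_scope.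
Local Open Scope ring_scope.
Set Implicit Arguments.
Unset Strict Implicit.
Unset Printing Implicit Defensive.

(** Write [E_0 = d_0, E_1 = d_1, E_2 = d_2 + x_1 d_3, E_3 = d_3] for the
    left-invariant frame, whose only non-zero bracket is [[E_1, E_2] = E_3], and
    [e^0, ..., e^3] for the dual coframe. Tensors with constant components in this
    frame are invariant under left translations, hence under any lattice, so it
    is enough to find both structures among them.

    Holomorphic symplectic structure. The functions [z = x_1 + i x_2] and
    [w = x_0 + x_1^2 / 2 + i x_3] form a global complex chart, and
    [dz = e^1 + i e^2], [dw = e^0 + i e^3 + x_1 dz]. The complex structure of the
    chart is therefore invariant, and so is the closed form
    [dz /\ dw = (e^1 + i e^2) /\ (e^0 + i e^3)].

    Generalized hypercomplex structure. Split [TM + T*M] as [H_1 + H_2], with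
    [H_1] spanned by [e^3, E_0, E_1, E_2] and [H_2] by [E_3, e^0, e^1, e^2]. Both
    are isotropic and they are dual to each other. Identify each with the
    quaternions, the first basis vector being the unit, and let a unit imaginary
    quaternion [n] act on both by left multiplication ([quat_mx], [kt_quat]).
    Orthogonality and the quaternion relations are immediate, and the operator is
    linear in [n], so the whole family is obtained at once.

    Integrability is a matter of dimension. On invariant sections the Courant
    bracket is the map from [H_1 x H_1] to [H_2] given by [[E_1, E_2] = E_3],
    [[E_1, e^3] = - e^2], [[E_2, e^3] = e^1], and it is zero on all other pairs;
    paired with a third section it is an alternating 3-form on [H_1]. The
    eigenbundle [L] of [n] is the sum of its intersections with [H_1] and [H_2],
    each of complex dimension 2, so the 3-form vanishes on [L] and the bracket of
    two sections of [L] lies in the orthogonal of [L], that is, in [L]. The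
    explicit form of this argument is [left_eigen_cross]. For sections with
    variable coefficients, [courantE] and [vpartial_shear] show that the terms
    containing derivatives also lie in [L], because [L] is isotropic and constant
    in the frame; see [kt_quat_integrable].

    Type. The operator of [n] is the product of a complex structure on the plane
    of [E_0, E_1, E_2] orthogonal to [n] with a symplectic structure on the plane
    of [n] and [E_3]. Accordingly [L] is the annihilator of
    [e^(i omega) theta], where [omega = - n /\ e^3] and [theta] is a complex
    1-form of that plane with [n x theta = i theta] ([kt_quat_type1]). This holds
    for every [n], so all types are 1. *)

(** * Calculus of real and complex functions *)

Section RealCalculus.
Context {R : realType} {n : nat}.
Implicit Types (f g : 'cV[R]_n -> R) (p : 'cV[R]_n) (j : 'I_n).

Lemma differentiable_entry p i : differentiable (fun q : 'cV[R]_n => q i 0) p.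
Proof. exact: differentiable_coord. Qed.

Lemma partial_cst j (c : R) p : partial j (fun=> c) p = 0.
Proof. exact: derive_cst. Qed.

Lemma partialD j f g p : differentiable f p -> differentiable g p ->
  partial j (fun q => f q + g q) p = partial j f p + partial j g p.
Proof. by move=> df dg; apply: deriveD; apply: diff_derivable. Qed.

Lemma partialB j f g p : differentiable f p -> differentiable g p ->
  partial j (fun q => f q - g q) p = partial j f p - partial j g p.
Proof. by move=> df dg; apply: deriveB; apply: diff_derivable. Qed.

Lemma partialM j f g p : differentiable f p -> differentiable g p ->
  partial j (fun q => f q * g q) p = partial j f p * g p + f p * partial j g p.
Proof.
move=> df dg; rewrite /partial deriveM; [|exact: diff_derivable..].
by rewrite addrC /GRing.scale /= [g p * _]mulrC.
Qed.

Lemma partial_entry j i p :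
  partial j (fun q : 'cV[R]_n => q i 0) p = (i == j)%:R.
Proof.
rewrite /partial deriveE; last exact: differentiable_entry.
pose h := (fun q : 'cV[R]_n => q i 0 : R).
have hl : linear h by move=> ? ? ?; rewrite /h !mxE.
pose hL : {linear 'cV[R]_n -> R} := HB.pack h (GRing.isLinear.Build _ _ _ _ h hl).
rewrite -[fun q : 'cV[R]_n => q i 0]/(hL : 'cV[R]_n -> R).
by rewrite diff_lin; [rewrite /= /h mxE eqxx andbT | exact: coord_continuous].
Qed.

Lemma partial_near j f g p : (\forall q \near p, f q = g q) ->
  partial j f p = partial j g p.
Proof. exact: near_eq_derive. Qed.

Lemma Cdiff_cst (k : nat) (c : R) : @Cdiff R n k setT (fun=> c).
Proof.
elim: k c => [|k IHk] c /=; first by move=> p _; exact: cst_continuous.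
split=> [p _|j]; first exact: differentiable_cst.
by have -> : partial j (fun=> c) = fun=> 0 by apply/funext => p; apply: partial_cst.
Qed.

Lemma smooth_cst (c : R) : @smooth R n setT (fun=> c).
Proof. by move=> k; apply: Cdiff_cst. Qed.

Lemma smooth_entry i : smooth setT (fun q : 'cV[R]_n => q i 0).
Proof.
case=> [|k] /=; first by move=> p _; exact: coord_continuous.
split=> [p _|j]; first exact: differentiable_entry.
rewrite (_ : partial j _ = fun=> (i == j)%:R); first exact: Cdiff_cst.
by apply/funext => p; apply: partial_entry.
Qed.

Lemma CdiffD (k : nat) f g : Cdiff k setT f -> Cdiff k setT g ->
  Cdiff k setT (fun q => f q + g q).
Proof.
elim: k f g => [|k IHk] f g /=.
  by move=> cf cg p _; apply: continuousD; [apply: cf|apply: cg].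
move=> [df Df] [dg Dg]; split=> [p _|j].
  by apply: differentiableD; [apply: df|apply: dg].
rewrite (_ : partial j _ = fun q => partial j f q + partial j g q).
  exact: IHk.
by apply/funext => p; apply: partialD; [apply: df|apply: dg].
Qed.

Lemma smoothD f g : smooth setT f -> smooth setT g ->
  smooth setT (fun q => f q + g q).
Proof. by move=> sf sg k; apply: CdiffD. Qed.

Lemma smooth_differentiable U f : smooth U f ->
  forall p, U p -> differentiable f p.
Proof. by move=> /(_ 1%N) []. Qed.

Lemma smooth_partial f j : smooth setT f -> smooth setT (partial j f).
Proof. by move=> sf k; have [_] := sf k.+1; apply. Qed.

(** The induction on the order of differentiability must carry the smoothness of
    both factors: the Leibniz rule replaces each factor by its derivatives. *)
Lemma smoothM f g : smooth setT f -> smooth setT g ->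
  smooth setT (fun q => f q * g q).
Proof.
move=> sf sg k; elim: k f g sf sg => [|k IHk] f g sf sg /=.
  by move=> p _; apply: continuousM; [apply: (sf 0%N)|apply: (sg 0%N)].
have df := smooth_differentiable sf; have dg := smooth_differentiable sg.
split=> [p _|j]; first by apply: differentiableM; [apply: df|apply: dg].
rewrite (_ : partial j _ = fun q => partial j f q * g q + f q * partial j g q).
  by apply: CdiffD; apply: IHk => //; apply: smooth_partial.
by apply/funext => p; apply: partialM; [apply: df|apply: dg].
Qed.

Lemma smooth_opp (h : 'cV[R]_n -> R) : smooth setT h ->
  smooth setT (fun p => - h p).
Proof.
move=> sh; under eq_fun do rewrite -mulN1r.
by apply: smoothM => //; exact: smooth_cst.
Qed.

Lemma smooth_sum m (F : 'I_m -> 'cV[R]_n -> R) :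
  (forall i, smooth setT (F i)) -> smooth setT (fun q => \sum_i F i q).
Proof.
elim: m F => [|m IHm] F sF.
  by under eq_fun do rewrite big_ord0; apply: smooth_cst.
under eq_fun do rewrite big_ord_recl.
by apply: smoothD => //; apply: IHm.
Qed.

Lemma smooth_mxM k l m (F : 'cV[R]_n -> 'M[R]_(k, l))
    (H : 'cV[R]_n -> 'M[R]_(l, m)) :
  smooth_mx setT F -> smooth_mx setT H -> smooth_mx setT (fun q => F q *m H q).
Proof.
move=> sF sH i j; under eq_fun do rewrite mxE.
by apply: smooth_sum => h; apply: smoothM.
Qed.

Lemma smooth_mx_cst k l (A : 'M[R]_(k, l)) :
  smooth_mx setT (fun _ : 'cV[R]_n => A).
Proof. by move=> i j; apply: smooth_cst. Qed.

End RealCalculus.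

Section ComplexCalculus.
Context {R : realType} {n : nat}.
Implicit Types (f g : 'cV[R]_n -> R[i]%C) (p : 'cV[R]_n) (j : 'I_n).

Definition cdifferentiable f p : Prop :=
  differentiable (fun q => complex.Re (f q)) p /\
  differentiable (fun q => complex.Im (f q)) p.

Lemma cpartialE j f p : cpartial j f p =
  (partial j (fun q => complex.Re (f q)) p
   +i* partial j (fun q => complex.Im (f q)) p)%C.
Proof. by []. Qed.

Lemma ReD (x y : R[i]%C) : complex.Re (x + y) = complex.Re x + complex.Re y.
Proof. by case: x y => [? ?] []. Qed.

Lemma ImD (x y : R[i]%C) : complex.Im (x + y) = complex.Im x + complex.Im y.
Proof. by case: x y => [? ?] []. Qed.

Lemma ReM (x y : R[i]%C) : complex.Re (x * y) =
  complex.Re x * complex.Re y - complex.Im x * complex.Im y.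
Proof. by case: x y => [? ?] []. Qed.

Lemma ImM (x y : R[i]%C) : complex.Im (x * y) =
  complex.Re x * complex.Im y + complex.Im x * complex.Re y.
Proof. by case: x y => [? ?] []. Qed.

Lemma cdifferentiable_cst (c : R[i]%C) p : cdifferentiable (fun=> c) p.
Proof. by split; exact: differentiable_cst. Qed.

Lemma cdifferentiableD f g p : cdifferentiable f p -> cdifferentiable g p ->
  cdifferentiable (fun q => f q + g q) p.
Proof.
move=> [fr fi] [gr gi]; split.
  by under eq_fun do rewrite ReD; exact: differentiableD.
by under eq_fun do rewrite ImD; exact: differentiableD.
Qed.

Lemma cdifferentiableM f g p : cdifferentiable f p -> cdifferentiable g p ->
  cdifferentiable (fun q => f q * g q) p.
Proof.
move=> [fr fi] [gr gi]; split.
  under eq_fun do rewrite ReM.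
  by apply: differentiableB; apply: differentiableM.
under eq_fun do rewrite ImM.
by apply: differentiableD; apply: differentiableM.
Qed.

Lemma cdifferentiable_sum m (F : 'I_m -> 'cV[R]_n -> R[i]%C) p :
  (forall i, cdifferentiable (F i) p) ->
  cdifferentiable (fun q => \sum_i F i q) p.
Proof.
elim: m F => [|m IHm] F dF.
  by under eq_fun do rewrite big_ord0; apply: cdifferentiable_cst.
under eq_fun do rewrite big_ord_recl.
by apply: cdifferentiableD => //; apply: IHm.
Qed.

Lemma cdifferentiable_real (h : 'cV[R]_n -> R) p : differentiable h p ->
  cdifferentiable (fun q => (h q)%:C%C) p.
Proof. by split=> //=; exact: differentiable_cst. Qed.

Lemma cpartial_cst j (c : R[i]%C) p : cpartial j (fun=> c) p = 0.
Proof. by rewrite cpartialE !partial_cst. Qed.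

Lemma cpartial_real j (h : 'cV[R]_n -> R) p :
  cpartial j (fun q => (h q)%:C%C) p = (partial j h p)%:C%C.
Proof. by rewrite cpartialE /= partial_cst. Qed.

Lemma cpartialD j f g p : cdifferentiable f p -> cdifferentiable g p ->
  cpartial j (fun q => f q + g q) p = cpartial j f p + cpartial j g p.
Proof.
move=> [fr fi] [gr gi]; rewrite !cpartialE.
under eq_fun do rewrite ReD.
under [X in (_ +i* partial j X _)%C = _]eq_fun do rewrite ImD.
by rewrite !partialD.
Qed.

Lemma cpartialM j f g p : cdifferentiable f p -> cdifferentiable g p ->
  cpartial j (fun q => f q * g q) p
  = cpartial j f p * g p + f p * cpartial j g p.
Proof.
move=> [fr fi] [gr gi]; rewrite !cpartialE.
under eq_fun do rewrite ReM.
under [X in (_ +i* partial j X _)%C = _]eq_fun do rewrite ImM.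
rewrite partialB ?partialD ?partialM //; try exact: differentiableM.
case: (f p) (g p) => [a b] [c d] /=.
by apply/eqP; rewrite eq_complex /=; apply/andP; split; apply/eqP; ring.
Qed.

Lemma cpartialZ j (c : R[i]%C) f p : cdifferentiable f p ->
  cpartial j (fun q => c * f q) p = c * cpartial j f p.
Proof.
by move=> df; rewrite cpartialM ?cpartial_cst ?mul0r ?add0r.
Qed.

Lemma cpartialB j f g p : cdifferentiable f p -> cdifferentiable g p ->
  cpartial j (fun q => f q - g q) p = cpartial j f p - cpartial j g p.
Proof.
move=> df dg; under eq_fun do rewrite -mulN1r.
have dc := @cdifferentiable_cst (-1) p.
by rewrite cpartialD ?cpartialZ ?mulN1r //; apply: cdifferentiableM.
Qed.

Lemma cpartial_sum j m (F : 'I_m -> 'cV[R]_n -> R[i]%C) p :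
  (forall i, cdifferentiable (F i) p) ->
  cpartial j (fun q => \sum_i F i q) p = \sum_i cpartial j (F i) p.
Proof.
elim: m F => [|m IHm] F dF.
  by under eq_fun do rewrite big_ord0; rewrite cpartial_cst big_ord0.
under eq_fun do rewrite big_ord_recl.
rewrite cpartialD //; last by apply: cdifferentiable_sum => i; apply: dF.
by rewrite big_ord_recl IHm.
Qed.

Lemma cpartial_near j f g p : (\forall q \near p, f q = g q) ->
  cpartial j f p = cpartial j g p.
Proof.
move=> fg; rewrite !cpartialE.
by congr Complex; apply: partial_near; apply: filterS fg => q ->.
Qed.

(** Sections of [TM + T*M] are differentiated entrywise in the coordinate frame;
    this flat derivative is not invariant, see [shear_bracket]. *)
Definition vpartial j k (s : 'cV[R]_n -> 'cV[R[i]%C]_k) p : 'cV[R[i]%C]_k :=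
  \col_i cpartial j (fun q => s q i 0) p.

Definition vdifferentiable k (s : 'cV[R]_n -> 'cV[R[i]%C]_k) p : Prop :=
  forall i, cdifferentiable (fun q => s q i 0) p.

Lemma csmooth_vdifferentiable U k (s : 'cV[R]_n -> 'cV[R[i]%C]_k) p :
  csmooth_mx U s -> U p -> vdifferentiable s p.
Proof.
move=> ss Up i; have [sr si] := ss i 0.
by split; [apply: (smooth_differentiable sr)|apply: (smooth_differentiable si)].
Qed.

Lemma vdifferentiable_mulmx k l (A : 'M[R[i]%C]_(k, l)) s p :
  vdifferentiable s p -> vdifferentiable (fun q => A *m s q) p.
Proof.
move=> ds i; under eq_fun do rewrite mxE.
by apply: cdifferentiable_sum => h; apply: cdifferentiableM.
Qed.

Lemma vpartial_mulmx j k l (A : 'M[R[i]%C]_(k, l)) s p :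
  vdifferentiable s p ->
  vpartial j (fun q => A *m s q) p = A *m vpartial j s p.
Proof.
move=> ds; apply/colP => i; rewrite !mxE.
under eq_fun do rewrite mxE.
rewrite cpartial_sum; first by apply: eq_bigr => h _; rewrite cpartialZ ?mxE.
by move=> h; apply: cdifferentiableM.
Qed.

Lemma vdifferentiable_scale k (h : 'cV[R]_n -> R) s p :
  differentiable h p -> @vdifferentiable k s p ->
  vdifferentiable (fun q => (h q)%:C%C *: s q) p.
Proof.
move=> dh ds i; under eq_fun do rewrite mxE.
by apply: cdifferentiableM => //; exact: cdifferentiable_real.
Qed.

Lemma vpartial_scale j k (h : 'cV[R]_n -> R) s p :
  differentiable h p -> @vdifferentiable k s p ->
  vpartial j (fun q => (h q)%:C%C *: s q) p
  = (partial j h p)%:C%C *: s p + (h p)%:C%C *: vpartial j s p.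
Proof.
move=> dh ds; apply/colP => i; rewrite !mxE.
under eq_fun do rewrite mxE.
by rewrite cpartialM ?cpartial_real //; exact: cdifferentiable_real.
Qed.

Lemma vpartialB j k (s t : 'cV[R]_n -> 'cV[R[i]%C]_k) p :
  vdifferentiable s p -> vdifferentiable t p ->
  vpartial j (fun q => s q - t q) p = vpartial j s p - vpartial j t p.
Proof.
move=> ds dt; apply/colP => i; rewrite !mxE -cpartialB //.
by under eq_fun do rewrite !mxE.
Qed.

Lemma vdifferentiableB k (s t : 'cV[R]_n -> 'cV[R[i]%C]_k) p :
  vdifferentiable s p -> vdifferentiable t p ->
  vdifferentiable (fun q => s q - t q) p.
Proof.
move=> ds dt i; under eq_fun do rewrite !mxE -mulN1r.
by apply: cdifferentiableD => //; apply: cdifferentiableM.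
Qed.

Lemma vpartial_near j k (s t : 'cV[R]_n -> 'cV[R[i]%C]_k) p :
  (\forall q \near p, s q = t q) -> vpartial j s p = vpartial j t p.
Proof.
move=> st; apply/colP => i; rewrite !mxE; apply: cpartial_near.
by apply: filterS st => q ->.
Qed.

End ComplexCalculus.

(** * The pairing and the Courant bracket *)

Section Pairing.
Context {K : fieldType} {n : nat}.
Implicit Types u v w : 'cV[K]_(n + n).

(** The pairing of [TM + T*M] over any field of scalars: real sections use it
    over [R], the eigenbundles use its complex bilinear extension. *)
Definition bpairing (u v : 'cV[K]_(n + n)) : K :=
  2^-1 * \sum_i (dsubmx u i 0 * usubmx v i 0 + dsubmx v i 0 * usubmx u i 0).

Definition pairing_mx : 'M[K]_(n + n) := block_mx 0 1%:M 1%:M 0.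

Lemma bpairingE u v : bpairing u v = 2^-1 * (u^T *m pairing_mx *m v) 0 0.
Proof.
congr (_ * _); rewrite -[u in RHS]vsubmxK -[v in RHS]vsubmxK.
rewrite tr_col_mx mul_row_block !mulmx0 !mulmx1 add0r addr0 mul_row_col.
rewrite mxE [X in X + _]mxE [X in _ + X]mxE -big_split; apply: eq_bigr => i _.
by rewrite !mxE [X in _ + X]mulrC.
Qed.

Lemma bpairingC u v : bpairing u v = bpairing v u.
Proof. by congr (_ * _); apply: eq_bigr => i _; rewrite addrC. Qed.

Lemma bpairingDl u v w : bpairing (u + v) w = bpairing u w + bpairing v w.
Proof. by rewrite !bpairingE linearD /= !mulmxDl mxE mulrDr. Qed.

Lemma bpairingZl a u v : bpairing (a *: u) v = a * bpairing u v.
Proof. by rewrite !bpairingE linearZ /= -!scalemxAl mxE mulrCA. Qed.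

Lemma bpairingDr u v w : bpairing u (v + w) = bpairing u v + bpairing u w.
Proof. by rewrite !(bpairingC u) bpairingDl. Qed.

Lemma bpairingZr a u v : bpairing u (a *: v) = a * bpairing u v.
Proof. by rewrite !(bpairingC u) bpairingZl. Qed.

Lemma bpairing_orthogonal (A : 'M[K]_(n + n)) u v :
  A^T *m pairing_mx *m A = pairing_mx ->
  bpairing (A *m u) (A *m v) = bpairing u v.
Proof.
move=> orth; rewrite !bpairingE trmx_mul -[in RHS]orth.
by rewrite !mulmxA.
Qed.

End Pairing.
Arguments pairing_mx {K} n.

Section Courant.
Context {R : realType} {n : nat}.
Implicit Types (s t : 'cV[R]_n -> 'cV[R[i]%C]_(n + n)) (p : 'cV[R]_n).

(** In coordinates the Courant bracket is the commutator of the flat directional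
    derivatives, corrected by a covector measuring how far [s] and [t] are from
    having constant pairing. The correction disappears when [s], [t] and their
    derivatives all lie in one isotropic subspace. *)
Lemma courantE s t p : vdifferentiable s p -> vdifferentiable t p ->
  courant s t p =
    \sum_i (usubmx (s p) i 0 *: vpartial i t p
            - usubmx (t p) i 0 *: vpartial i s p)
    + col_mx 0 (\col_j (bpairing (vpartial j s p) (t p)
                        - bpairing (s p) (vpartial j t p))).
Proof.
move=> ds dt.
have dus i : cdifferentiable (fun q => usubmx (s q) i 0) p.
  by under eq_fun do rewrite mxE; apply: ds.
have dut i : cdifferentiable (fun q => usubmx (t q) i 0) p.
  by under eq_fun do rewrite mxE; apply: dt.
have dds i : cdifferentiable (fun q => dsubmx (s q) i 0) p.
  by under eq_fun do rewrite mxE; apply: ds.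
have ddt i : cdifferentiable (fun q => dsubmx (t q) i 0) p.
  by under eq_fun do rewrite mxE; apply: dt.
have pu (r : 'cV[R]_n -> 'cV[R[i]%C]_(n + n)) j i :
  cpartial j (fun q => usubmx (r q) i 0) p = vpartial j r p (lshift n i) 0.
  by under eq_fun do rewrite mxE; rewrite mxE.
have pd (r : 'cV[R]_n -> 'cV[R[i]%C]_(n + n)) j i :
  cpartial j (fun q => dsubmx (r q) i 0) p = vpartial j r p (rshift n i) 0.
  by under eq_fun do rewrite mxE; rewrite mxE.
have lin (a b : R[i]%C) (v w : 'cV[R[i]%C]_(n + n)) k :
  (a *: v - b *: w) k 0 = a * v k 0 - b * w k 0 by rewrite !mxE.
apply/colP => j; rewrite -[j]splitK /courant; case: (fintype.split j) => {}j /=.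
  rewrite [RHS]mxE summxE !col_mxEu [X in _ = _ + X]mxE addr0 mxE.
  by apply: eq_bigr => i _; rewrite !pu lin.
rewrite [RHS]mxE summxE !col_mxEd [X in _ = _ + X]mxE.
set D := differential _ _.
have -> : (lie_derivative (fun q => usubmx (s q)) (fun q => dsubmx (t q)) p
  - lie_derivative (fun q => usubmx (t q)) (fun q => dsubmx (s q)) p
  - 2^-1 *: D) j 0
 = (\sum_i (usubmx (s p) i 0 * vpartial i t p (rshift n j) 0
            + dsubmx (t p) i 0 * vpartial j s p (lshift n i) 0))
 - (\sum_i (usubmx (t p) i 0 * vpartial i s p (rshift n j) 0
            + dsubmx (s p) i 0 * vpartial j t p (lshift n i) 0))
 - 2^-1 * D j 0.
  rewrite 2!mxE [(- (2^-1 *: D)) _ _]mxE [(2^-1 *: D) _ _]mxE.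
  congr (_ + _ - _); first by rewrite mxE; apply: eq_bigr => i _; rewrite pd pu.
  by rewrite 2!mxE; congr (- _); apply: eq_bigr => i _; rewrite pd pu.
rewrite {}/D [differential _ _ _ _]mxE /contract cpartialB; first last.
- by apply: cdifferentiable_sum => i; apply: cdifferentiableM.
- by apply: cdifferentiable_sum => i; apply: cdifferentiableM.
rewrite !cpartial_sum; try by move=> i; apply: cdifferentiableM.
rewrite /bpairing -mulrBr -!sumrB !mulr_sumr -sumrN -!big_split.
apply: eq_bigr => i _; rewrite !cpartialM // !pu !pd lin.
rewrite ![usubmx (vpartial _ _ _) _ _]mxE ![dsubmx (vpartial _ _ _) _ _]mxE /=.
by field.
Qed.

End Courant.

(** * The left-invariant frame *)

Lemma sum_ord4 (V : nmodType) (F : 'I_4 -> V) :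
  \sum_i F i = F 0 + F 1 + F 2 + F 3.
Proof.
rewrite !big_ord_recl big_ord0 addr0 !addrA.
by congr (_ + _ + _ + _); congr F; apply: val_inj.
Qed.

Lemma ord4_ind (P : 'I_4 -> Prop) : P 0 -> P 1 -> P 2 -> P 3 -> forall i, P i.
Proof.
move=> P0 P1 P2 P3 [[|[|[|[|k]]]] hk] //.
- by rewrite (_ : Ordinal hk = 0) //; apply: val_inj.
- by rewrite (_ : Ordinal hk = 1) //; apply: val_inj.
- by rewrite (_ : Ordinal hk = 2) //; apply: val_inj.
- by rewrite (_ : Ordinal hk = 3) //; apply: val_inj.
Qed.

Ltac mx4_ring := apply/matrixP; elim/ord4_ind; elim/ord4_ind;
  rewrite ?(mxE, sum_ord4) /=; ring.

Section Frame.
Context {K : comNzRingType}.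
Implicit Types (t : K).

(** The columns are the left-invariant fields [d_0, d_1, d_2 + t d_3, d_3] at a
    point with [x_1 = t]. Only [t] enters, and additively: this is why the
    frames form a one-parameter group. *)
Definition frame t : 'M[K]_4 := 1%:M + t *: delta_mx 3 2.

(** The induced frame of [TM + T*M]. *)
Definition gframe t : 'M[K]_(4 + 4) :=
  block_mx (frame t) 0 0 (frame (- t))^T.

(** The infinitesimal generator of [gframe], of square zero. *)
Definition shear : 'M[K]_(4 + 4) :=
  block_mx (delta_mx 3 2) 0 0 (- delta_mx 2 3).

Lemma frameD s t : frame s *m frame t = frame (s + t).
Proof.
rewrite /frame mulmxDl !mulmxDr !mulmx1 mul1mx -scalemxAl -scalemxAr.
by rewrite mul_delta_mx_0 // !scaler0 addr0 scalerDl addrA addrAC.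
Qed.

Lemma frame0 : frame 0 = 1%:M.
Proof. by rewrite /frame scale0r addr0. Qed.

Lemma gframeD s t : gframe s *m gframe t = gframe (s + t).
Proof.
rewrite /gframe mulmx_block !mulmx0 !mul0mx !addr0 !add0r frameD.
by rewrite -trmx_mul frameD opprD [- t + _]addrC.
Qed.

Lemma gframe0 : gframe 0 = 1%:M.
Proof. by rewrite /gframe oppr0 frame0 trmx1 -scalar_mx_block. Qed.

Lemma gframeK t : gframe t *m gframe (- t) = 1%:M.
Proof. by rewrite gframeD subrr gframe0. Qed.

Lemma gframeNK t : gframe (- t) *m gframe t = 1%:M.
Proof. by rewrite gframeD addNr gframe0. Qed.

Lemma gframeE t : gframe t = 1%:M + t *: shear.
Proof.
rewrite /gframe /shear (scalar_mx_block 4 4) scale_block_mx add_block_mx.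
by rewrite !scaler0 !addr0 /frame linearD /= trmx1 linearZ /= trmx_delta scaleNr scalerN.
Qed.

Lemma shear_sqr : shear *m shear = 0.
Proof.
rewrite /shear mulmx_block !mulmx0 !mul0mx !addr0 !add0r mulmxN mulNmx.
by rewrite !mul_delta_mx_0 // !oppr0 block_mx0.
Qed.

Lemma gframe_shear t : gframe t *m shear = shear.
Proof. by rewrite gframeE mulmxDl mul1mx -scalemxAl shear_sqr scaler0 addr0. Qed.

End Frame.

(** * Left multiplication by imaginary quaternions *)

Section Quaternions.
Context {K : comNzRingType}.
Implicit Types (a b c : K).

Definition mx4 (r : seq (seq K)) : 'M[K]_4 :=
  \matrix_(i, j) nth 0 (nth [::] r i) j.

Definition cross_mx a b c : 'M[K]_4 :=
  mx4 [:: [:: 0; - c; b; 0]; [:: c; 0; - a; 0]; [:: - b; a; 0; 0]].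

Definition mix_mx a b c : 'M[K]_4 :=
  mx4 [:: [:: 0; 0; 0; a]; [:: 0; 0; 0; b]; [:: 0; 0; 0; c];
          [:: - a; - b; - c; 0]].

(** Let [E_i] be the invariant frame and [e^i] the dual coframe. Take
    [e^3, E_0, E_1, E_2] for the basis [1, i, j, k] of a copy of the quaternions
    and [E_3, e^0, e^1, e^2] for that of a second one. In the frame [E, e] this is
    the left multiplication by [a i + b j + c k] on both copies: [cross_mx] is
    the cross product, [mix_mx] exchanges real and imaginary parts. *)
Definition quat_mx a b c : 'M[K]_(4 + 4) :=
  block_mx (cross_mx a b c) (mix_mx a b c) (mix_mx a b c) (cross_mx a b c).

Lemma quat_mxE a b c (x y : 'cV[K]_4) :
  quat_mx a b c *m col_mx x y =
  col_mx
    (\col_i nth 0 [:: a * y 3 0 + (b * x 2 0 - c * x 1 0);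
                      b * y 3 0 + (c * x 0 0 - a * x 2 0);
                      c * y 3 0 + (a * x 1 0 - b * x 0 0);
                      - (a * y 0 0 + b * y 1 0 + c * y 2 0)] i)
    (\col_i nth 0 [:: a * x 3 0 + (b * y 2 0 - c * y 1 0);
                      b * x 3 0 + (c * y 0 0 - a * y 2 0);
                      c * x 3 0 + (a * y 1 0 - b * y 0 0);
                      - (a * x 0 0 + b * x 1 0 + c * x 2 0)] i).
Proof.
rewrite /quat_mx mul_block_col; congr col_mx; apply/colP; elim/ord4_ind;
  rewrite !mxE !sum_ord4 !mxE /=; ring.
Qed.

Lemma quat_mxM a b c a' b' c' :
  quat_mx a b c *m quat_mx a' b' c' =
  quat_mx (b * c' - c * b') (c * a' - a * c') (a * b' - b * a')
  - (a * a' + b * b' + c * c')%:M.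
Proof.
have diag : cross_mx a b c *m cross_mx a' b' c' + mix_mx a b c *m mix_mx a' b' c'
    = cross_mx (b * c' - c * b') (c * a' - a * c') (a * b' - b * a')
      - (a * a' + b * b' + c * c')%:M by mx4_ring.
have off : cross_mx a b c *m mix_mx a' b' c' + mix_mx a b c *m cross_mx a' b' c'
    = mix_mx (b * c' - c * b') (c * a' - a * c') (a * b' - b * a') by mx4_ring.
rewrite /quat_mx mulmx_block diag off [X in block_mx _ _ X _]addrC off.
rewrite [X in block_mx _ _ _ X]addrC diag.
by rewrite (scalar_mx_block 4 4) opp_block_mx add_block_mx !oppr0 !addr0.
Qed.

Lemma quat_mx_lin a b c x y z :
  x *: quat_mx a 0 0 + y *: quat_mx 0 b 0 + z *: quat_mx 0 0 c
  = quat_mx (x * a) (y * b) (z * c).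
Proof.
rewrite /quat_mx !scale_block_mx !add_block_mx.
by congr block_mx; mx4_ring.
Qed.

Lemma quat_mx0 : quat_mx 0 0 0 = 0 :> 'M[K]_(4 + 4).
Proof.
by have := quat_mx_lin 0 0 0 0 0 0; rewrite !scale0r !addr0 !mulr0 => <-.
Qed.

Lemma quat_mx_sqr a b c : a ^+ 2 + b ^+ 2 + c ^+ 2 = 1 ->
  quat_mx a b c *m quat_mx a b c = - 1%:M.
Proof.
move=> abc; rewrite quat_mxM -!expr2 abc.
by rewrite [c * b]mulrC [c * a]mulrC [b * a]mulrC !subrr quat_mx0 sub0r.
Qed.

Lemma quat_mxN a b c : quat_mx (- a) (- b) (- c) = - quat_mx a b c.
Proof. by rewrite /quat_mx opp_block_mx; congr block_mx; mx4_ring. Qed.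

Lemma tr_quat_mx a b c : (quat_mx a b c)^T = - quat_mx a b c.
Proof.
rewrite /quat_mx tr_block_mx opp_block_mx.
by congr block_mx; mx4_ring.
Qed.

(** The same operator in coordinates, at a point with [x_1 = t]. *)
Definition kt_quat a b c t := gframe t *m quat_mx a b c *m gframe (- t).

End Quaternions.

Section KTQuaternions.
Context {K : fieldType}.

Lemma pairing_gframe (t : K) :
  (gframe t)^T *m pairing_mx 4 *m gframe t = pairing_mx 4.
Proof.
rewrite /gframe tr_block_mx !trmx0 !mulmx_block.
rewrite !(mulmx0, mul0mx, mulmx1, add0r, addr0) trmxK.
by rewrite -trmx_mul !frameD !addNr frame0 trmx1.
Qed.

Lemma pairing_quat (a b c : K) :
  pairing_mx 4 *m quat_mx a b c = quat_mx a b c *m pairing_mx 4.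
Proof. by rewrite !mulmx_block !(mulmx0, mul0mx, mulmx1, mul1mx, add0r, addr0). Qed.

(** The two quaternionic lines are isotropic and dual to each other, and left
    multiplication by an imaginary quaternion is antisymmetric of square -1, so
    it is orthogonal. *)
Lemma pairing_kt_quat (a b c t : K) : a ^+ 2 + b ^+ 2 + c ^+ 2 = 1 ->
  (kt_quat a b c t)^T *m pairing_mx 4 *m kt_quat a b c t = pairing_mx 4.
Proof.
move=> abc; rewrite /kt_quat.
have -> (g q h P : 'M[K]_(4 + 4)) : (g *m q *m h)^T *m P *m (g *m q *m h)
    = h^T *m (q^T *m (g^T *m P *m g) *m q) *m h.
  by rewrite !trmx_mul !mulmxA.
rewrite pairing_gframe tr_quat_mx !mulNmx -pairing_quat.
by rewrite -[_ *m _ a b c *m _]mulmxA quat_mx_sqr // !(mulmxN, mulNmx, opprK) mulmx1 pairing_gframe.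
Qed.

Lemma kt_quatM (a b c a' b' c' t : K) :
  kt_quat a b c t *m kt_quat a' b' c' t
  = gframe t *m (quat_mx a b c *m quat_mx a' b' c') *m gframe (- t).
Proof.
have mid (g q q' h : 'M[K]_(4 + 4)) : h *m g = 1%:M ->
    g *m q *m h *m (g *m q' *m h) = g *m (q *m q') *m h.
  by move=> hg; rewrite !mulmxA -(mulmxA _ h) hg mulmx1.
by apply: mid; exact: gframeNK.
Qed.

(** Invariance under left translation by an element with [x_1 = s]: its
    differential carries the frame at [t] to the frame at [s + t]. *)
Lemma kt_quat_shift (a b c s t : K) :
  kt_quat a b c (s + t) *m gframe s = gframe s *m kt_quat a b c t.
Proof.
rewrite /kt_quat -[LHS]mulmxA gframeD opprD addrAC addNr add0r -gframeD.
by rewrite !mulmxA.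
Qed.

Lemma kt_quat_sqr (a b c t : K) : a ^+ 2 + b ^+ 2 + c ^+ 2 = 1 ->
  kt_quat a b c t *m kt_quat a b c t = - 1%:M.
Proof.
by move=> abc; rewrite kt_quatM quat_mx_sqr // mulmxN mulNmx mulmx1 gframeK.
Qed.

Lemma kt_quat_lin (a b c t : K) :
  a *: kt_quat 1 0 0 t + b *: kt_quat 0 1 0 t + c *: kt_quat 0 0 1 t
  = kt_quat a b c t.
Proof.
have := quat_mx_lin 1 1 1 a b c; rewrite !mulr1 /kt_quat => <-.
by rewrite !mulmxDr !mulmxDl -!scalemxAr -!scalemxAl.
Qed.

Lemma kt_quat_ij t :
  kt_quat 0 0 1 t = kt_quat 1 0 0 t *m kt_quat 0 1 0 t :> 'M[K]_(4 + 4).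
Proof.
rewrite kt_quatM quat_mxM !(mulr0, mul0r, mulr1, addr0, subr0).
by rewrite raddf0 subr0.
Qed.

Lemma kt_quat_anticomm (a b c a' b' c' t : K) :
  a * a' + b * b' + c * c' = 0 ->
  kt_quat a b c t *m kt_quat a' b' c' t
  = - (kt_quat a' b' c' t *m kt_quat a b c t).
Proof.
move=> orth; rewrite !kt_quatM !quat_mxM orth.
rewrite [a' * a]mulrC [b' * b]mulrC [c' * c]mulrC orth raddf0 !subr0.
rewrite -mulNmx -mulmxN; congr (_ *m _ *m _).
by rewrite -quat_mxN; congr quat_mx; ring.
Qed.

End KTQuaternions.

(** * The bracket of invariant sections *)

Lemma sqrN1_neq0 (K : numFieldType) (z : K) : z ^+ 2 = -1 -> z != 0.
Proof.
move=> z2; apply/eqP => ze; move/eqP: z2.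
by rewrite ze expr0n /= eq_sym oppr_eq0 oner_eq0.
Qed.

Section ShearBracket.
Context {K : numFieldType}.

(** The quaternion [t + x0 i + x1 j + x2 k] is an eigenvector, of eigenvalue [z],
    of the left multiplication by [a i + b j + c k]. *)
Definition left_eigen (z a b c t x0 x1 x2 : K) : Prop :=
  [/\ - (a * x0 + b * x1 + c * x2) = z * t,
      a * t + (b * x2 - c * x1) = z * x0,
      b * t + (c * x0 - a * x2) = z * x1 &
      c * t + (a * x1 - b * x0) = z * x2].

Lemma quat_mx_eigenP (z a b c : K) (x y : 'cV[K]_4) :
  quat_mx a b c *m col_mx x y = z *: col_mx x y <->
  left_eigen z a b c (y 3 0) (x 0 0) (x 1 0) (x 2 0) /\
  left_eigen z a b c (x 3 0) (y 0 0) (y 1 0) (y 2 0).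
Proof.
rewrite quat_mxE scale_col_mx.
split=> [/eq_col_mx[/colP ex /colP ey]|[[x3 y0 y1 y2] [y3 x0 x1 x2]]].
  by split; split;
    first [ by have := ey 3; rewrite !mxE | by have := ex 0; rewrite !mxE
          | by have := ex 1; rewrite !mxE | by have := ex 2; rewrite !mxE
          | by have := ex 3; rewrite !mxE | by have := ey 0; rewrite !mxE
          | by have := ey 1; rewrite !mxE | by have := ey 2; rewrite !mxE ].
by congr col_mx; apply/colP; elim/ord4_ind; rewrite !mxE.
Qed.

(** The algebraic core of integrability. The Courant bracket of invariant
    sections takes two vectors of the first quaternionic line to the second one,
    by the cross product of their components along [E_1, E_2, e^3]. Paired with
    a third vector it is a 3-form, and the z-eigenspace in the first line has
    dimension 2, so that 3-form vanishes on it; hence the bracket is orthogonal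
    to the eigenbundle, which is its own orthogonal. Concretely, all bivectors
    of that eigenspace are multiples of a single self-dual one, and the only
    consequence used is [x1 y2 - x2 y1 = t y0 - t' x0]. *)
Lemma left_eigen_cross (z a b c t x0 x1 x2 t' y0 y1 y2 : K) :
  z ^+ 2 = -1 ->
  left_eigen z a b c t x0 x1 x2 -> left_eigen z a b c t' y0 y1 y2 ->
  left_eigen z a b c (x1 * y2 - x2 * y1) 0 (x2 * t' - t * y2)
                     (t * y1 - x1 * t').
Proof.
move=> z2 [xt ex0 ex1 ex2] [yt ey0 ey1 ey2].
have z0 := sqrN1_neq0 z2.
(* With P = t y - t' x and Q the cross product of x and y, the eigenvector
   equations give z P = n x P and 2 z Q = n x P + z P, hence P = Q. *)
have z20 : 2 * z != 0 by rewrite mulf_neq0 // pnatr_eq0.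
have P0 : x1 * y2 - x2 * y1 = t * y0 - t' * x0.
  apply: (mulfI z20).
  have -> : 2 * z * (x1 * y2 - x2 * y1)
    = (z * x1) * y2 - (z * x2) * y1 + x1 * (z * y2) - x2 * (z * y1) by ring.
  have -> : 2 * z * (t * y0 - t' * x0)
    = (z * t) * y0 - (z * t') * x0 + t * (z * y0) - t' * (z * x0) by ring.
  by rewrite -xt -yt -ex0 -ex1 -ex2 -ey0 -ey1 -ey2; ring.
rewrite P0; split.
- have -> : z * (t * y0 - t' * x0) = t * (z * y0) - t' * (z * x0) by ring.
  by rewrite -ex0 -ey0; ring.
- have -> : a * (t * y0 - t' * x0) + (b * (t * y1 - x1 * t') - c * (x2 * t' - t * y2))
    = t' * - (a * x0 + b * x1 + c * x2) - t * - (a * y0 + b * y1 + c * y2)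
    by ring.
  rewrite mulr0 xt yt; ring.
- have -> : z * (x2 * t' - t * y2) = t' * (z * x2) - t * (z * y2) by ring.
  by rewrite -ex2 -ey2; ring.
- have -> : z * (t * y1 - x1 * t') = t * (z * y1) - t' * (z * x1) by ring.
  by rewrite -ex1 -ey1; ring.
Qed.

(** The Courant bracket at a point of two sections with constant components in
    the invariant frame and with values [u] and [v] at that point: such a
    section [s] satisfies [d_j s = 0] for [j != 1] and [d_1 s = shear s]. *)
Definition shear_bracket (u v : 'cV[K]_(4 + 4)) : 'cV[K]_(4 + 4) :=
  usubmx u 1 0 *: (shear *m v) - usubmx v 1 0 *: (shear *m u)
  + col_mx 0 (2 * bpairing (shear *m u) v *: delta_mx 1 0).

Lemma mul_shear (x y : 'cV[K]_4) :
  shear *m col_mx x y = col_mx (x 2 0 *: delta_mx 3 0) (- (y 3 0 *: delta_mx 2 0)).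
Proof.
rewrite mul_block_col !mul0mx addr0 add0r mulNmx.
by congr col_mx; [|congr (- _)]; apply/colP; elim/ord4_ind;
  rewrite !mxE !sum_ord4 !mxE /=; ring.
Qed.

Lemma bpairing_shear (u v : 'cV[K]_(4 + 4)) :
  bpairing (shear *m u) v = - bpairing u (shear *m v).
Proof.
have skew : shear^T *m pairing_mx 4 = - (pairing_mx 4 *m shear) :> 'M[K]_(4 + 4).
  rewrite tr_block_mx !mulmx_block opp_block_mx !trmx0 linearN /= !trmx_delta.
  by rewrite !(mulmx0, mul0mx, mulmx1, mul1mx, add0r, addr0, oppr0, opprK).
rewrite !bpairingE trmx_mul -[_ *m _^T *m _]mulmxA skew !(mulmxN, mulNmx).
by rewrite -!mulmxA mxE mulrN.
Qed.

Lemma shear_bracketE (x xi y eta : 'cV[K]_4) :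
  shear_bracket (col_mx x xi) (col_mx y eta) =
  col_mx ((x 1 0 * y 2 0 - x 2 0 * y 1 0) *: delta_mx 3 0)
         ((x 2 0 * eta 3 0 - xi 3 0 * y 2 0) *: delta_mx 1 0
          + (xi 3 0 * y 1 0 - x 1 0 * eta 3 0) *: delta_mx 2 0).
Proof.
rewrite /shear_bracket !mul_shear /bpairing !col_mxKu !col_mxKd sum_ord4.
rewrite mulrA mulfV ?pnatr_eq0 // mul1r.
rewrite !scale_col_mx opp_col_mx !add_col_mx.
by congr col_mx; apply/colP; elim/ord4_ind; rewrite !mxE /=; ring.
Qed.

Lemma gframeN_col (t : K) (x y : 'cV[K]_4) :
  gframe (- t) *m col_mx x y =
  col_mx (x - (t * x 2 0) *: delta_mx 3 0) (y + (t * y 3 0) *: delta_mx 2 0).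
Proof.
rewrite gframeE mulmxDl mul1mx -scalemxAl mul_shear scale_col_mx add_col_mx.
by rewrite scalerN !scaleNr opprK !scalerA.
Qed.

End ShearBracket.

(** * Integrability *)

Section Integrability.
Context {R : realType}.
Implicit Types (a b c t : R).
Local Notation C := R[i]%C.

Lemma map_frame t : cmx (frame t) = frame t%:C%C.
Proof. by rewrite /cmx /frame map_mxD map_mx1 map_mxZ map_delta_mx. Qed.

Lemma map_gframe t : cmx (gframe t) = gframe t%:C%C.
Proof.
rewrite /cmx /gframe map_block_mx !map_mx0 -map_trmx -![map_mx _ _]/(cmx _).
by rewrite !map_frame rmorphN.
Qed.

Lemma map_quat_mx a b c : cmx (quat_mx a b c) = quat_mx a%:C%C b%:C%C c%:C%C.
Proof.
rewrite /cmx /quat_mx map_block_mx.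
by congr block_mx; apply/matrixP => -[[|[|[|[|i]]]] ?] [[|[|[|[|j]]]] ?] //;
  rewrite !mxE /= ?rmorphN ?rmorph0.
Qed.

Lemma map_kt_quat a b c t :
  cmx (kt_quat a b c t) = kt_quat a%:C%C b%:C%C c%:C%C t%:C%C.
Proof.
rewrite /kt_quat {1}/cmx !map_mxM -![map_mx _ _]/(cmx _).
by rewrite !map_gframe map_quat_mx rmorphN.
Qed.

Lemma eigenL_lin n (A : 'M[R]_(n + n)) x y u v :
  eigenL A u -> eigenL A v -> eigenL A (x *: u + y *: v).
Proof.
rewrite /eigenL => Au Av.
by rewrite mulmxDr -!scalemxAr Au Av scalerDr !scalerA ![_ * 'i%C]mulrC.
Qed.

Lemma eigenL_sum n (A : 'M[R]_(n + n)) (I : finType) (F : I -> 'cV[C]_(n + n)) :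
  (forall i, eigenL A (F i)) -> eigenL A (\sum_i F i).
Proof.
rewrite /eigenL => AF; rewrite mulmx_sumr scaler_sumr.
by apply: eq_bigr => i _.
Qed.

(** [<u, v> = <A u, A v> = i^2 <u, v>]. *)
Lemma eigenL_isotropic n (A : 'M[R]_(n + n)) u v :
  A^T *m pairing_mx n *m A = pairing_mx n -> eigenL A u -> eigenL A v ->
  bpairing u v = 0.
Proof.
move=> orthA Au Av.
have orthC : (cmx A)^T *m pairing_mx n *m cmx A = pairing_mx n.
  have mapQ : cmx (pairing_mx n) = pairing_mx n :> 'M[C]_(n + n).
    by rewrite /cmx /pairing_mx map_block_mx !map_mx0 !map_mx1.
  by rewrite -{1}mapQ /cmx map_trmx -!map_mxM orthA -/(cmx _) mapQ.
have := bpairing_orthogonal u v orthC.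
rewrite Au Av bpairingZl bpairingZr mulrA -expr2 sqr_i mulN1r => /eqP.
by rewrite -subr_eq0 -opprD oppr_eq0 -mulr2n mulrn_eq0 => /eqP.
Qed.

Lemma eigenL_kt_quatP a b c t u :
  eigenL (kt_quat a b c t) u <->
  quat_mx a%:C%C b%:C%C c%:C%C *m (gframe (- t%:C%C) *m u)
  = 'i%C *: (gframe (- t%:C%C) *m u).
Proof.
rewrite /eigenL map_kt_quat /kt_quat; split=> [eu|eu].
  rewrite scalemxAr -eu -!mulmxA [gframe (- _) *m (gframe _ *m _)]mulmxA.
  by rewrite gframeNK mul1mx.
by rewrite -!mulmxA eu -scalemxAr mulmxA gframeK mul1mx.
Qed.

Lemma eigenL_colP a b c t (x y : 'cV[C]_4) :
  let z := 'i%C in let a' := a%:C%C in let b' := b%:C%C in let c' := c%:C%C in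
  eigenL (kt_quat a b c t) (col_mx x y) <->
  left_eigen z a' b' c' (y 3 0) (x 0 0) (x 1 0) (x 2 0) /\
  left_eigen z a' b' c' (x 3 0 - t%:C%C * x 2 0)
             (y 0 0) (y 1 0) (y 2 0 + t%:C%C * y 3 0).
Proof.
apply: (iff_trans (eigenL_kt_quatP _ _ _ _ _)).
rewrite gframeN_col; apply: (iff_trans (quat_mx_eigenP _ _ _ _ _ _)).
by rewrite !mxE /= !mulr1 !mulr0 ?subr0 ?addr0.
Qed.

Lemma eigenL_shear_bracket a b c t u v :
  eigenL (kt_quat a b c t) u -> eigenL (kt_quat a b c t) v ->
  eigenL (kt_quat a b c t) (shear_bracket u v).
Proof.
rewrite -[u]vsubmxK -[v]vsubmxK shear_bracketE.
move=> /eigenL_colP[eu _] /eigenL_colP[ev _]; apply/eigenL_colP.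
rewrite !mxE /= !(mulr1, mulr0, subr0, addr0, add0r); split.
  by split; rewrite !(mulr0, subr0, addr0, oppr0).
by have := left_eigen_cross (sqr_i R) eu ev; rewrite !mxE.
Qed.

(** In the invariant frame the section takes its values in one fixed eigenspace,
    and so do its derivatives; [shear] is the price of differentiating in the
    coordinate frame instead. *)
Lemma vpartial_shear j (s : 'cV[R]_4 -> 'cV[C]_(4 + 4)) a b c (U : set 'cV[R]_4) p :
  open U -> U p -> vdifferentiable s p ->
  (forall q, U q -> eigenL (kt_quat a b c (q 1 0)) (s q)) ->
  eigenL (kt_quat a b c (p 1 0)) (vpartial j s p - (1 == j)%:R *: (shear *m s p)).
Proof.
move=> oU Up ds es; apply/eigenL_kt_quatP.
set A := quat_mx _ _ _.
(* The components of s in the invariant frame. *)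
pose sigma q := s q - (q 1 0)%:C%C *: (shear *m s q).
have sigmaE q : sigma q = gframe (- (q 1 0)%:C%C) *m s q.
  by rewrite gframeE mulmxDl mul1mx -scalemxAl scaleNr.
have dx := @differentiable_entry R 4 p 1.
have dNs := vdifferentiable_mulmx shear ds.
have dsig : vdifferentiable sigma p.
  by apply: vdifferentiableB => //; exact: vdifferentiable_scale.
have Dsig : vpartial j sigma p
    = gframe (- (p 1 0)%:C%C) *m (vpartial j s p - (1 == j)%:R *: (shear *m s p)).
  rewrite vpartialB //; last exact: vdifferentiable_scale.
  rewrite vpartial_scale // vpartial_mulmx // partial_entry.
  rewrite rmorph_nat mulmxBr [gframe _ *m (_ *: _)]linearZ /= [gframe _ *m (shear *m _)]mulmxA.
  rewrite gframe_shear gframeE mulmxDl mul1mx -scalemxAl scaleNr.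
  by rewrite opprD addrA addrAC.
rewrite -Dsig; apply/eqP; rewrite -subr_eq0 -mul_scalar_mx -mulmxBl.
rewrite -vpartial_mulmx // (@vpartial_near _ _ _ _ _ (fun=> 0)).
  by apply/eqP/colP => i; rewrite !mxE cpartial_cst.
have : \forall q \near p, U q by exact: open_nbhs_nbhs.
apply: filterS => q Uq; rewrite mulmxBl mul_scalar_mx sigmaE.
by apply/eqP; rewrite subr_eq0; apply/eqP/eigenL_kt_quatP/es.
Qed.

(** The eigenbundle is isotropic and stable under the derivative [nabla] along
    the frame. Rewriting [courantE] with [nabla] therefore leaves derivatives
    that lie in the eigenbundle, and the zero-order term [shear_bracket]. *)
Theorem kt_quat_integrable a b c : a ^+ 2 + b ^+ 2 + c ^+ 2 = 1 ->
  courant_integrable (fun p : 'cV[R]_4 => kt_quat a b c (p 1 0)).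
Proof.
move=> abc U s t oU ss st es et p Up.
have ds := csmooth_vdifferentiable ss Up.
have dt := csmooth_vdifferentiable st Up.
pose nabla r j := vpartial j r p - (1 == j)%:R *: (shear *m r p).
have nablaK r j : vpartial j r p = nabla r j + (1 == j)%:R *: (shear *m r p).
  by rewrite subrK.
have ens j : eigenL (kt_quat a b c (p 1 0)) (nabla s j).
  exact: (vpartial_shear j oU Up ds es).
have ent j : eigenL (kt_quat a b c (p 1 0)) (nabla t j).
  exact: (vpartial_shear j oU Up dt et).
clearbody nabla.
have isotropic := eigenL_isotropic (pairing_kt_quat (p 1 0) abc).
have -> : courant s t p =
    \sum_i (usubmx (s p) i 0 *: nabla t i - usubmx (t p) i 0 *: nabla s i)
    + shear_bracket (s p) (t p).
  rewrite courantE // /shear_bracket addrA; congr (_ + col_mx 0 _).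
    have delta (F : 'I_4 -> 'cV[C]_(4 + 4)) : \sum_i (1 == i)%:R *: F i = F 1.
      rewrite (bigD1 1) //= scale1r big1 ?addr0 // => i.
      by rewrite eq_sym => /negbTE ->; rewrite scale0r.
    rewrite -[_ *: (shear *m t p)](delta (fun i => usubmx (s p) i 0 *: (shear *m t p))).
    rewrite -[_ *: (shear *m s p)](delta (fun i => usubmx (t p) i 0 *: (shear *m s p))).
    rewrite -sumrB -big_split; apply: eq_bigr => i _ /=.
    rewrite !nablaK !scalerDr !scalerA ![_ * (1 == i)%:R]mulrC.
    by rewrite opprD addrACA.
  apply/colP => j; rewrite !mxE !nablaK !bpairingDl !bpairingDr.
  rewrite !bpairingZl !bpairingZr (isotropic _ _ (ens j) (et p Up)).
  rewrite (isotropic _ _ (es p Up) (ent j)) !add0r -mulrBr bpairing_shear.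
  by rewrite eqxx andbT [j == 1]eq_sym; ring.
rewrite -[_ + _]scale1r scalerDr; apply: eigenL_lin.
  apply: eigenL_sum => i; rewrite -scaleNr; exact: eigenL_lin.
by apply: eigenL_shear_bracket; [exact: es|exact: et].
Qed.

End Integrability.

(** * The generalized hypercomplex structure *)

Section GeneralizedHypercomplex.
Context {R : realType}.
Implicit Types (a b c t : R) (Gam : set 'cV[R]_4).

Lemma jac_kt_mul (g p : 'cV[R]_4) : jac (kt_mul g) p = frame (g 1 0).
Proof.
apply/matrixP => i j; rewrite !mxE.
under eq_fun do rewrite mxE.
have dx k : differentiable (fun q : 'cV[R]_4 => q k 0) p.
  exact: differentiable_entry.
have dc (c : R) : differentiable (fun _ : 'cV[R]_4 => c) p by exact: differentiable_cst.
rewrite partialD; [|exact: differentiableD|]; last first.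
  by case: (i == 3) => //; apply: differentiableM.
rewrite partialD // partial_cst partial_entry add0r; congr (_ + _).
case: (i == 3); last by rewrite partial_cst mulr0.
rewrite partialM // partial_cst mul0r add0r partial_entry /= eq_sym.
by [].
Qed.

Lemma kt_mul1 (g p : 'cV[R]_4) : kt_mul g p 1 0 = g 1 0 + p 1 0.
Proof. by rewrite mxE addr0. Qed.

Lemma unit_frame t : frame t \in unitmx.
Proof.
by case: (@mulmx1_unit _ _ (frame t) (frame (- t))) => //; rewrite frameD subrr frame0.
Qed.

Lemma invmx_frame t : invmx (frame t) = frame (- t).
Proof.
apply: (can_inj (mulKmx (unit_frame t))).
by rewrite mulmxV ?unit_frame // frameD subrr frame0.
Qed.

Lemma gpush_frame t : gpush (frame t) = gframe t.
Proof. by rewrite /gpush invmx_frame. Qed.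

Lemma smooth_gframe (h : 'cV[R]_4 -> R) : smooth setT h ->
  smooth_mx setT (fun p => gframe (h p)).
Proof.
move=> sh i j; under eq_fun do rewrite gframeE !mxE.
by apply: smoothD; [|apply: smoothM]; try exact: smooth_cst.
Qed.

Theorem kt_quat_gcs Gam a b c : a ^+ 2 + b ^+ 2 + c ^+ 2 = 1 ->
  KT_gcs Gam (fun p => kt_quat a b c (p 1 0)).
Proof.
move=> abc; split.
- apply: smooth_mxM; last by apply/smooth_gframe/smooth_opp/smooth_entry.
  apply: smooth_mxM; last exact: smooth_mx_cst.
  by apply/smooth_gframe/smooth_entry.
- move=> g p _; rewrite jac_kt_mul gpush_frame kt_mul1.
  exact: kt_quat_shift.
- move=> p u v; apply: (@bpairing_orthogonal R 4).
  exact: pairing_kt_quat.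
- by move=> p; apply: kt_quat_sqr.
- exact: kt_quat_integrable.
Qed.

Theorem kt_quat_hypercomplex Gam :
  KT_generalized_hypercomplex Gam
    (fun p => kt_quat 1 0 0 (p 1 0)) (fun p => kt_quat 0 1 0 (p 1 0))
    (fun p => kt_quat 0 0 1 (p 1 0)).
Proof.
split.
- by split; [|split]; apply: kt_quat_gcs; rewrite !expr0n !expr1n /= ?addr0 ?add0r.
- by split; [|split]=> p; apply: kt_quat_anticomm; rewrite !(mulr0, mul0r, addr0).
- by move=> p; apply: kt_quat_ij.
- move=> a b c abc.
  rewrite (_ : sphere_member _ _ _ _ _ _ = fun p => kt_quat a b c (p 1 0)).
    exact: kt_quat_gcs.
  by apply/funext => p; apply: kt_quat_lin.
Qed.

End GeneralizedHypercomplex.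

(** * Exterior algebra *)

Section ExteriorAlgebra.
Import boot.finset.
Local Close Scope classical_set_scope.
Context {R : realType} {n : nat}.
Local Notation C := R[i]%C.
Local Notation form := (@Defs.form R n).
Local Notation sign := (@shuffle_sign R n).
Implicit Types (A S T : {set 'I_n}) (a b c : form) (i j : 'I_n).
Implicit Types (xi eta X : 'cV[C]_n).

(** As a product over pairs the sign becomes multiplicative in each argument,
    which is all that the identities below need. *)
Lemma shuffle_signE S T :
  sign S T = \prod_(i in S) \prod_(j in T | (j < i)%N) (-1).
Proof.
rewrite pair_big_dep /= prodr_const /shuffle_sign; congr (_ ^+ _).
by apply: eq_card => ij; exact: asboolb.
Qed.

Lemma prod_setU S T (F : 'I_n -> C) : [disjoint S & T] ->
  \prod_(i in S :|: T) F i = (\prod_(i in S) F i) * \prod_(i in T) F i.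
Proof. by move=> dST; rewrite -bigU //; apply: eq_bigl => i; rewrite !inE. Qed.

Lemma shuffle_signUl S T A : [disjoint S & T] ->
  sign (S :|: T)%SET A = sign S A * sign T A.
Proof. by move=> dST; rewrite !shuffle_signE prod_setU. Qed.

Lemma shuffle_signUr S T A : [disjoint S & T] ->
  sign A (S :|: T)%SET = sign A S * sign A T.
Proof.
move=> dST; rewrite !shuffle_signE -big_split; apply: eq_bigr => i _.
rewrite [LHS]big_mkcondr prod_setU //=.
by congr (_ * _); rewrite [RHS]big_mkcondr.
Qed.

Lemma shuffle_sign0l A : sign set0 A = 1.
Proof. by rewrite shuffle_signE big_set0. Qed.

Lemma shuffle_sign0r A : sign A set0 = 1.
Proof.
rewrite shuffle_signE big1 // => i _; apply: big_pred0 => j.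
by rewrite in_set0.
Qed.

Lemma shuffle_sign_sqr S T : sign S T * sign S T = 1.
Proof. by rewrite /shuffle_sign -expr2 sqrr_sign. Qed.

Lemma shuffle_sign11 i j : sign [set i]%SET [set j]%SET = (-1) ^+ (j < i)%N.
Proof.
rewrite shuffle_signE big_set1 big_mkcondr big_set1.
by case: ltnP.
Qed.

Lemma shuffle_sign_swap i j : i != j ->
  sign [set i]%SET [set j]%SET * sign [set j]%SET [set i]%SET = -1.
Proof.
move=> ij; rewrite !shuffle_sign11.
by case: ltngtP ij => [||/val_inj->]; rewrite ?eqxx ?mul1r ?mulr1.
Qed.

Lemma wedgeDl a b c : wedge (a + b) c = wedge a c + wedge b c.
Proof.
apply/ffunP => A; rewrite !ffunE -big_split; apply: eq_bigr => S _.
by rewrite ffunE mulrDr mulrDl.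
Qed.

Lemma wedgeDr a b c : wedge a (b + c) = wedge a b + wedge a c.
Proof.
apply/ffunP => A; rewrite !ffunE -big_split; apply: eq_bigr => S _.
by rewrite ffunE mulrDr.
Qed.

Lemma wedgeZl (k : C) a b : wedge (k *: a) b = k *: wedge a b.
Proof.
apply/ffunP => A; rewrite !ffunE scaler_sumr; apply: eq_bigr => S _.
by rewrite ffunE /GRing.scale /=; ring.
Qed.

Lemma wedgeZr (k : C) a b : wedge a (k *: b) = k *: wedge a b.
Proof.
apply/ffunP => A; rewrite !ffunE scaler_sumr; apply: eq_bigr => S _.
by rewrite ffunE /GRing.scale /=; ring.
Qed.

Lemma wedge0r a : wedge a 0 = 0.
Proof. by have := wedgeZr 0 a 0; rewrite !scale0r. Qed.

Lemma wedge1l a : wedge form_one a = a.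
Proof.
apply/ffunP => A; rewrite ffunE (bigD1 set0) ?sub0set //= big1 => [|S].
  by rewrite ffunE eqxx setD0 shuffle_sign0l !mul1r addr0.
by move=> /andP[_ /negbTE S0]; rewrite ffunE S0 mulr0 mul0r.
Qed.

Lemma wedge1r a : wedge a form_one = a.
Proof.
apply/ffunP => A; rewrite ffunE (bigD1 A) //= big1 => [|S /andP[SA neSA]].
  by rewrite ffunE setDv eqxx shuffle_sign0r mul1r mulr1 addr0.
rewrite ffunE setD_eq0 (_ : (A \subset S) = false) ?mulr0 //.
by apply: contraNF neSA => AS; rewrite eqEsubset SA.
Qed.

(** Both sides sum over the ordered partitions of [A] in three blocks; on the
    right they are indexed by the union of the first two blocks. *)
Lemma wedgeA a b c : wedge a (wedge b c) = wedge (wedge a b) c.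
Proof.
apply/ffunP => A; rewrite !ffunE.
under [RHS]eq_bigr => S _ do rewrite ffunE mulr_sumr mulr_suml.
rewrite [RHS](exchange_big_dep (fun T => T \subset A)) /=; last first.
  by move=> S T SA TS; exact: fintype.subset_trans TS SA.
apply: eq_bigr => T TA; rewrite ffunE mulr_sumr.
rewrite [RHS](reindex_onto (fun W => T :|: W)%SET (fun S => S :\: T)%SET); last first.
  by move=> S /andP[_ TS]; rewrite -{1}(setIidPr TS) setID.
have disjT W : ((T :|: W) :\: T == W)%SET = [disjoint T & W].
  rewrite setDUl setDv set0U disjoint_sym.
  by apply/eqP/idP => [/setDidPl|/setDidPl].
apply: eq_big => [W|W].
  by rewrite subUset TA subsetUl /= andbT disjT subsetD disjoint_sym.
rewrite subsetD => /andP[WA dWT].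
have dTW : [disjoint T & W] by rewrite disjoint_sym.
have /eqP -> : ((T :|: W) :\: T == W)%SET by rewrite disjT.
have -> : (A :\: (T :|: W) = A :\: T :\: W)%SET by rewrite setDDl.
set Z := (A :\: T :\: W)%SET.
have dTZ : [disjoint W & Z].
  by rewrite disjoint_sym /Z disjoints_subset subDset setUCr subsetT.
have -> : (A :\: T = W :|: Z)%SET.
  rewrite /Z -{1}(setID (A :\: T)%SET W); congr (_ :|: _)%SET.
  apply/setIidPr; by rewrite subsetD WA.
rewrite shuffle_signUl // shuffle_signUr //; ring.
Qed.

Lemma wedge_form1E xi a A : wedge (form1 xi) a A =
  \sum_(i in A) sign [set i]%SET (A :\ i)%SET * xi i 0 * a (A :\ i)%SET.
Proof.
rewrite ffunE.
under eq_bigr => S _ do rewrite ffunE mulr_sumr mulr_suml.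
rewrite (exchange_big_dep (fun i => i \in A)) /=; last first.
  by move=> S i SA /eqP SE; rewrite -sub1set -SE.
apply: eq_bigr => i iA; rewrite (big_pred1 [set i]%SET) // => S /=.
by case: eqP => [->|]; rewrite ?andbF // sub1set iA.
Qed.

Lemma form1_eq0 xi : (form1 xi == 0 :> form) = (xi == 0).
Proof.
apply/eqP/eqP => [/ffunP xi0|->].
  apply/colP => i; have := xi0 [set i]%SET; rewrite !ffunE (big_pred1 i) ?mxE // => j.
  by rewrite /= (inj_eq set1_inj) eq_sym.
by apply/ffunP => A; rewrite !ffunE big1 // => i _; rewrite mxE.
Qed.

Lemma form1D xi eta : form1 (xi + eta) = form1 xi + form1 eta :> form.
Proof.
apply/ffunP => A; rewrite !ffunE -big_split.
by apply: eq_bigr => i _; rewrite mxE.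
Qed.

Lemma form1Z k xi : form1 (k *: xi) = k *: form1 xi :> form.
Proof.
apply/ffunP => A; rewrite !ffunE scaler_sumr.
by apply: eq_bigr => i _; rewrite mxE.
Qed.

Lemma sign_setD1 i j A : j \in A -> i != j ->
  sign [set i]%SET (A :\ i)%SET
  = sign [set i]%SET [set j]%SET * sign [set i]%SET (A :\ i :\ j)%SET.
Proof.
move=> jA ij; rewrite -shuffle_signUr ?setD1K //.
  by rewrite !inE eq_sym ij.
by rewrite disjoints1 !inE eqxx.
Qed.

(** Pairing the term [(i, j)] of one side with [(j, i)] of the other leaves only
    the sign of the transposition. *)
Lemma wedge_form1_anticomm xi eta a :
  wedge (form1 xi) (wedge (form1 eta) a)
  = - wedge (form1 eta) (wedge (form1 xi) a).
Proof.
have E x y A : wedge (form1 x) (wedge (form1 y) a) A =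
    \sum_(i in A) \sum_(j in A :\ i)
      sign [set i]%SET [set j]%SET * (sign [set i]%SET (A :\ i :\ j)%SET
      * sign [set j]%SET (A :\ i :\ j)%SET * x i 0 * y j 0 * a (A :\ i :\ j)%SET).
  rewrite wedge_form1E; apply: eq_bigr => i iA.
  rewrite wedge_form1E mulr_sumr; apply: eq_bigr => j.
  rewrite !inE => /andP[ji jA]; rewrite (@sign_setD1 i j) // 1?eq_sym //; ring.
apply/ffunP => A; rewrite [RHS]ffunE !E -sumrN.
under [RHS]eq_bigr => i _ do rewrite -sumrN.
rewrite [RHS](exchange_big_dep (fun j => j \in A)) /=; last first.
  by move=> i j _; rewrite !inE => /andP[].
apply: eq_bigr => i iA; apply: eq_big => [j|j].
  by rewrite !inE iA andbT eq_sym; case: (j \in A); case: eqP.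
rewrite !inE => /andP[ji jA].
have -> : (A :\ j :\ i = A :\ i :\ j)%SET by rewrite !setDDl setUC.
have := @shuffle_sign_swap i j; rewrite eq_sym => /(_ ji) sw.
have -> : sign [set j]%SET [set i]%SET = - sign [set i]%SET [set j]%SET.
  apply: (can_inj (mulKf (_ : sign [set i]%SET [set j]%SET != 0))).
    by rewrite shuffle_sign11 signr_eq0.
  by rewrite sw mulrN shuffle_sign_sqr.
ring.
Qed.

Lemma wedge_form1_sqr xi a : wedge (form1 xi) (wedge (form1 xi) a) = 0.
Proof.
apply/ffunP => A; have /ffunP/(_ A)/eqP := wedge_form1_anticomm xi xi a.
rewrite [X in _ == X]ffunE -subr_eq0 opprK -mulr2n mulrn_eq0 => /eqP ->.
by rewrite ffunE.
Qed.

Lemma interiorD X a b : Defs.interior X (a + b) = Defs.interior X a + Defs.interior X b.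
Proof.
apply/ffunP => A; rewrite !ffunE -big_split; apply: eq_bigr => i _.
by rewrite ffunE mulrDr.
Qed.

Lemma interiorZ X k a : Defs.interior X (k *: a) = k *: Defs.interior X a.
Proof.
apply/ffunP => A; rewrite !ffunE scaler_sumr; apply: eq_bigr => i _.
by rewrite ffunE /GRing.scale /=; ring.
Qed.

Lemma interior_one X : Defs.interior X form_one = 0.
Proof.
apply/ffunP => A; rewrite !ffunE big1 // => i _.
rewrite ffunE (_ : (i |: A == set0)%SET = false) ?mulr0 //.
by apply/eqP => /setP/(_ i); rewrite !inE eqxx.
Qed.

(** The index contracted and the index of the wedge either coincide, which
    happens once for each [i], whether or not it belongs to the degree [A], or
    differ, and then exchanging them costs the sign of a transposition. *)
Lemma interior_wedge X xi a :
  Defs.interior X (wedge (form1 xi) a)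
  = (\sum_i xi i 0 * X i 0) *: a - wedge (form1 xi) (Defs.interior X a).
Proof.
pose F A i j := sign [set i]%SET (A :\ j) * sign [set j]%SET (A :\ j)
                * X i 0 * xi j 0 * a (i |: (A :\ j)).
have left A i : i \notin A ->
    sign [set i]%SET A * X i 0 * wedge (form1 xi) a (i |: A)
    = xi i 0 * X i 0 * a A - \sum_(j in A) F A i j.
  move=> iA; rewrite wedge_form1E big_setU1 //= setU1K // mulrDr; congr (_ + _).
    by rewrite -[RHS]mul1r -(shuffle_sign_sqr [set i]%SET A); ring.
  rewrite mulr_sumr -sumrN; apply: eq_bigr => j jA.
  have ij : i != j by apply: contraNneq iA => ->.
  have dij : [disjoint [set i]%SET & A :\ j] by rewrite disjoints1 !inE negb_and iA orbT.
  have -> : (i |: A) :\ j = i |: (A :\ j).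
    by apply/setP => k; rewrite !inE; case: (k =P i) => [->|//]; rewrite ij.
  rewrite /F shuffle_signUr // -{1}(setD1K jA) shuffle_signUr; last first.
    by rewrite disjoints1 !inE eqxx.
  rewrite -[RHS]mulN1r -(shuffle_sign_swap ij); ring.
have right A j : j \in A ->
    sign [set j]%SET (A :\ j) * xi j 0 * Defs.interior X a (A :\ j)
    = xi j 0 * X j 0 * a A + \sum_(i | i \notin A) F A i j.
  move=> jA; rewrite ffunE (bigD1 j) /= ?inE ?eqxx // setD1K // mulrDr.
  congr (_ + _).
    by rewrite -[RHS]mul1r -(shuffle_sign_sqr [set j]%SET (A :\ j)); ring.
  rewrite mulr_sumr; apply: eq_big => [i|i _]; last by rewrite /F; ring.
  by rewrite !inE negb_and negbK; case: eqP => [->|_]; rewrite ?jA ?andbT ?andbF.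
apply/ffunP => A; rewrite [LHS]ffunE.
rewrite [RHS]ffunE [(_ *: a) A]ffunE [(- wedge _ _) A]ffunE wedge_form1E.
rewrite (eq_bigr _ (left A)) (eq_bigr _ (right A)) big_split sumrN big_split /=.
rewrite [X in _ - X]exchange_big /= opprD addrA; congr (_ - _).
rewrite -!mulr_suml /GRing.scale /= -mulrBl; congr (_ * _).
by rewrite [X in _ = X - _](bigID (fun i => i \in A)) /= addrAC subrr add0r.
Qed.

Lemma form2_wedge (alpha beta : 'cV[C]_n) :
  form2 (alpha *m beta^T - beta *m alpha^T)
  = wedge (form1 alpha) (form1 beta) :> form.
Proof.
apply/ffunP => A; rewrite wedge_form1E ffunE.
pose G i j : C := sign [set i]%SET [set j]%SET * alpha i 0 * beta j 0.
have -> : \sum_(i in A) sign [set i]%SET (A :\ i) * alpha i 0 * form1 beta (A :\ i)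
    = \sum_i \sum_(j | (i != j) && (A == [set i; j]%SET)) G i j.
  rewrite big_mkcond; apply: eq_bigr => i _; case: ifPn => [iA|iA].
    rewrite ffunE mulr_sumr; apply: eq_big => [j|j /eqP-> //].
    apply/eqP/andP => [E|[ij /eqP ->]].
      split; first by apply/eqP => ij; have := set11 j; rewrite -E -ij !inE eqxx.
      by rewrite -(setD1K iA) E.
    by apply/setP => k; rewrite !inE; case: (k =P i) => [->|]//=; rewrite (negbTE ij).
  by rewrite big_pred0 // => j; apply: contraNF iA => /andP[_ /eqP ->]; rewrite !inE eqxx.
rewrite pair_big_dep /= [RHS](bigID (fun ij : 'I_n * 'I_n => (ij.1 < ij.2)%N)) /=.
have swap_inj : injective (fun ij : 'I_n * 'I_n => (ij.2, ij.1)).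
  by move=> [? ?] [? ?] [-> ->].
rewrite [X in _ = _ + X](reindex_inj swap_inj) /=.
pose lt_pair (ij : 'I_n * 'I_n) := (ij.1 < ij.2)%N && (A == [set ij.1; ij.2]%SET).
rewrite [X in _ = X + _](eq_bigl lt_pair); last first.
  move=> [i j]; rewrite /lt_pair /= andbC.
  by case: ltngtP; rewrite // -?(inj_eq val_inj); case: ltngtP.
rewrite [X in _ = _ + X](eq_bigl lt_pair); last first.
  move=> [i j]; rewrite /lt_pair /= setUC andbC -leqNgt.
  by rewrite -(inj_eq val_inj) /= ; case: ltngtP.
rewrite -big_split; apply: eq_bigr => -[i j] /= /andP[ij _].
rewrite /G !shuffle_sign11 ij ltnNge (ltnW ij) /= !mxE !big_ord1 !mxE.
by ring.
Qed.

Lemma form2_pair (b : 'M[C]_n) i j : (i < j)%N ->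
  form2 b [set i; j]%SET = b i j.
Proof.
move=> ij; rewrite ffunE (big_pred1 (i, j)) // => -[k l] /=.
apply/andP/eqP => [[kl /eqP/setP E]|[-> ->]]; last by rewrite ij eqxx.
have := E i; have := E j; have := E k; have := E l; rewrite !inE !eqxx orbT /=.
move=> lij kij _ _; move: kl; case/orP: lij kij => /eqP-> /orP[] /eqP->;
  by rewrite ?ltnn // ltnNge (ltnW ij).
Qed.

Lemma wedge_form1_set0 xi a : wedge (form1 xi) a finset.set0 = 0.
Proof. by rewrite wedge_form1E big_set0. Qed.

(** The components [zeta_i theta_j - zeta_j theta_i] of the product vanish exactly
    when the two covectors are proportional. *)
Lemma wedge_form1_eq0 (zeta theta : 'cV[C]_n) : theta != 0 ->
  wedge (form1 zeta) (form1 theta) = 0 :> form <->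
  exists k, zeta = k *: theta.
Proof.
move=> nz; split=> [Y0|[k ->]]; last first.
  rewrite form1Z wedgeZl -[form1 theta in X in wedge _ X]wedge1r.
  by rewrite wedge_form1_sqr scaler0.
have cross i j : zeta i 0 * theta j 0 = zeta j 0 * theta i 0.
  have lt (k l : 'I_n) : (k < l)%N -> zeta k 0 * theta l 0 = zeta l 0 * theta k 0.
    move=> kl; apply/eqP; rewrite -subr_eq0 [zeta l 0 * _]mulrC.
    move/ffunP/(_ [set k; l]): Y0; rewrite -form2_wedge form2_pair // ffunE.
    by rewrite !mxE !big_ord1 !mxE => ->.
  by case: (ltngtP i j) => [/lt|/lt|/val_inj ->].
have [i nzi] : exists i, theta i 0 != 0.
  by have /matrix0Pn[i [j]] := nz; rewrite ord1 => nzi; exists i.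
exists (zeta i 0 / theta i 0); apply/colP => j; rewrite mxE mulrAC cross.
by rewrite mulfK.
Qed.

(** The annihilator of the spinor [e^b theta], with [b = k alpha /\ beta] of
    square zero. Moving [e^b] to the left turns [X + xi] into [X + zeta], where
    [zeta = xi + i_X b], and [e^b] is invertible; so the condition is
    [theta(X) + zeta /\ theta = 0], whose two terms have different degrees. *)
Lemma clifford_eq0 (k : C) (alpha beta theta X xi : 'cV[C]_n) :
  let ev (eta : 'cV[C]_n) := \sum_i eta i 0 * X i 0 in
  theta != 0 ->
  clifford (col_mx X xi)
    (wedge (form_one + k *: wedge (form1 alpha) (form1 beta)) (form1 theta)) = 0
  <-> ev theta = 0 /\
      exists l, xi + (k * ev alpha) *: beta - (k * ev beta) *: alpha = l *: theta.
Proof.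
move=> ev nz.
set zeta := xi + _ - _.
pose one := form_one : form.
pose W x a := wedge (form1 x) a : form.
have WD x a b : W x (a + b) = W x a + W x b by exact: wedgeDr.
have WZ x l a : W x (l *: a) = l *: W x a by exact: wedgeZr.
have WN x a : W x (- a) = - W x a by rewrite -scaleN1r WZ scaleN1r.
have WC x y a : W x (W y a) = - W y (W x a) by exact: wedge_form1_anticomm.
have WW x a : W x (W x a) = 0 by exact: wedge_form1_sqr.
have IW x a : Defs.interior X (W x a) = ev x *: a - W x (Defs.interior X a).
  exact: interior_wedge.
pose Y := W zeta (W theta one).
have Wzeta a : W zeta a
    = W xi a + (k * ev alpha) *: W beta a - (k * ev beta) *: W alpha a.
  by rewrite /W /zeta -scaleNr !form1D !form1Z !wedgeDl !wedgeZl scaleNr.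
have W0 x : W x 0 = 0 by exact: wedge0r.
(* Y is zeta /\ theta. *)
have YE : clifford (col_mx X xi)
    (wedge (one + k *: wedge (form1 alpha) (form1 beta)) (form1 theta))
  = ev theta *: (one + k *: W alpha (W beta one)) + Y
    + k *: W alpha (W beta Y).
  rewrite /clifford col_mxKu col_mxKd wedgeDl wedge1l wedgeZl -wedgeA.
  rewrite -[form1 theta]wedge1r -/one -![wedge (form1 _) _]/(W _ _).
  rewrite interiorD interiorZ !IW interior_one !WD !WN !W0 !WZ.
  set t := W theta one.
  have swap : W alpha (W beta (W xi t)) = W xi (W alpha (W beta t)).
    by rewrite (WC beta) WN (WC alpha) opprK.
  have kill : W alpha (W beta (W alpha t)) = 0.
    by rewrite (WC beta) WN WW oppr0.
  rewrite /Y Wzeta !WD !WN !WZ swap kill WW W0.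
  rewrite -/t; move: (W xi (W alpha _)) (W alpha (W beta one)) (W xi t) (W alpha t).
  move: (W beta t) (one) (ev theta) (ev alpha) (ev beta) => f1 f2 c1 c2 c3 f3 f4 f5 f6.
  rewrite !(subr0, addr0, scaler0) opprB !scalerDr !scalerN !scalerA.
  rewrite [c1 * k]mulrC.
  by rewrite [LHS](AC ((1*(1*2))*2) (((1*3)*((5*2)*4))*6)).
have formDE (a b : form) A : (a + b) A = a A + b A by rewrite ffunE.
have formZE l (a : form) A : (l *: a) A = l * a A by rewrite ffunE.
have Wset0 x a : W x a finset.set0 = 0 by exact: wedge_form1_set0.
split=> [|[th0 [l zl]]].
  rewrite YE => eq0.
  have th0 : ev theta = 0.
    have /ffunP/(_ finset.set0) := eq0.
    rewrite 2!formDE formZE formDE !formZE !Wset0 !mulr0 !addr0.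
    by rewrite !ffunE eqxx mulr1.
  move: eq0; rewrite th0 scale0r add0r => eq0.
  have Y0 : Y = 0.
    have := congr1 (fun a => W alpha (W beta a)) eq0.
    have kill : W alpha (W beta (W alpha (W beta Y))) = 0.
      by rewrite (WC beta alpha) WN WW oppr0.
    rewrite !WD !WZ kill !(W0, scaler0, addr0) => e.
    by rewrite e scaler0 addr0 in eq0.
  split=> //; apply/(wedge_form1_eq0 _ nz).
  by move: Y0; rewrite /Y /W /one wedge1r.
rewrite YE th0 scale0r add0r.
have -> : Y = 0.
  rewrite /Y /W /one wedge1r; apply/(wedge_form1_eq0 _ nz); by exists l.
by rewrite !W0 scaler0 addr0.
Qed.

End ExteriorAlgebra.

(** * The type of the structures *)

Section CrossEigenvectors.
Context {K : numFieldType} (z a b c : K).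
Context (z2 : z ^+ 2 = -1) (n1 : a ^+ 2 + b ^+ 2 + c ^+ 2 = 1).

(** [n x v = l v], for the unit vector [n = (a, b, c)]. On [K^3] the operator
    [n x _] has eigenvalues [0, z, - z], with kernel spanned by [n]. *)
Definition cross_eigen (l v0 v1 v2 : K) : Prop :=
  [/\ b * v2 - c * v1 = l * v0, c * v0 - a * v2 = l * v1 &
      a * v1 - b * v0 = l * v2].

Let z0 : z != 0.
Proof. exact: sqrN1_neq0. Qed.

Let z20 : 2 * z != 0.
Proof. by rewrite mulf_neq0 // pnatr_eq0. Qed.

Lemma cross_eigen_orth l v0 v1 v2 : l != 0 -> cross_eigen l v0 v1 v2 ->
  a * v0 + b * v1 + c * v2 = 0.
Proof.
move=> l0 [e0 e1 e2]; apply: (mulfI l0).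
have -> : l * (a * v0 + b * v1 + c * v2) = a * (l * v0) + b * (l * v1) + c * (l * v2).
  by ring.
by rewrite -e0 -e1 -e2; ring.
Qed.

Context (th0 th1 th2 : K) (th : cross_eigen z th0 th1 th2).
Context (nz : [|| th0 != 0, th1 != 0 | th2 != 0]).

Let thn : a * th0 + b * th1 + c * th2 = 0.
Proof. exact: cross_eigen_orth th. Qed.

Lemma cross_eigen_collinear v0 v1 v2 :
  v0 * th1 = v1 * th0 -> v1 * th2 = v2 * th1 -> v2 * th0 = v0 * th2 ->
  exists l, [/\ v0 = l * th0, v1 = l * th1 & v2 = l * th2].
Proof.
move=> e01 e12 e20; case/or3P: nz => nzi.
- exists (v0 / th0); split; apply: (mulIf nzi); rewrite mulrAC mulfVK ?e01 ?e20 //.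
- exists (v1 / th1); split; apply: (mulIf nzi); rewrite mulrAC mulfVK ?e01 ?e12 //.
- exists (v2 / th2); split; apply: (mulIf nzi); rewrite mulrAC mulfVK ?e20 ?e12 //.
Qed.

(** [v] and [theta] are both eigenvectors orthogonal to [n]; expanding the double
    products in [z (v x theta) = (n x v) x theta = v x (n x theta)] gives opposite
    values, so [v x theta = 0]. *)
Lemma cross_eigen_unique v0 v1 v2 : cross_eigen z v0 v1 v2 ->
  exists l, [/\ v0 = l * th0, v1 = l * th1 & v2 = l * th2].
Proof.
move=> v; have vn := cross_eigen_orth z0 v; case: v => e0 e1 e2.
case: th => f0 f1 f2.
pose vth := v0 * th0 + v1 * th1 + v2 * th2.
apply: cross_eigen_collinear; apply: (mulfI z20).
- transitivity (z * v0 * th1 + v0 * (z * th1)); first by ring.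
  transitivity (z * v1 * th0 + v1 * (z * th0)); last by ring.
  rewrite -e0 -e1 -f0 -f1; apply/eqP; rewrite -subr_eq0; apply/eqP.
  transitivity (v2 * (a * th0 + b * th1 + c * th2) - (a * v0 + b * v1 + c * v2) * th2).
    by ring.
  by rewrite thn vn mulr0 mul0r subrr.
- transitivity (z * v1 * th2 + v1 * (z * th2)); first by ring.
  transitivity (z * v2 * th1 + v2 * (z * th1)); last by ring.
  rewrite -e2 -e1 -f2 -f1; apply/eqP; rewrite -subr_eq0; apply/eqP.
  transitivity (v0 * (a * th0 + b * th1 + c * th2) - (a * v0 + b * v1 + c * v2) * th0).
    by ring.
  by rewrite thn vn mulr0 mul0r subrr.
- transitivity (z * v2 * th0 + v2 * (z * th0)); first by ring.
  transitivity (z * v0 * th2 + v0 * (z * th2)); last by ring.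
  rewrite -e2 -e0 -f2 -f0; apply/eqP; rewrite -subr_eq0; apply/eqP.
  transitivity (v1 * (a * th0 + b * th1 + c * th2) - (a * v0 + b * v1 + c * v2) * th1).
    by ring.
  by rewrite thn vn mulr0 mul0r subrr.
Qed.

(** The part of the eigenbundle in the line spanned by [e^3, E_0, E_1, E_2] is
    [theta = 0, t = z n(x)]: the complex plane of the [x] spanned by [n] and
    [theta], the latter being isotropic. *)
Lemma left_eigen_vectorP t x0 x1 x2 :
  left_eigen z a b c t x0 x1 x2 <->
  th0 * x0 + th1 * x1 + th2 * x2 = 0 /\ t = z * (a * x0 + b * x1 + c * x2).
Proof.
case: (th) => f0 f1 f2; split=> [[et e0 e1 e2]|[thx et]].
  split.
    apply: (mulfI z20).
    transitivity (z * th0 * x0 + th0 * (z * x0) + z * th1 * x1 + th1 * (z * x1)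
                  + z * th2 * x2 + th2 * (z * x2)); first by ring.
    rewrite -e0 -e1 -e2 -f0 -f1 -f2.
    transitivity (t * (a * th0 + b * th1 + c * th2)); first by ring.
    by rewrite thn !mulr0.
  apply: (mulfI z0); rewrite -et mulrA -expr2 z2; ring.
pose s := a * x0 + b * x1 + c * x2.
pose w0 := b * x2 - c * x1 - z * (x0 - s * a).
pose w1 := c * x0 - a * x2 - z * (x1 - s * b).
pose w2 := a * x1 - b * x0 - z * (x2 - s * c).
(* w is orthogonal to n and to theta, hence a multiple of theta and a
   z-eigenvector; but by construction n x w = - z w, so w = 0. *)
have wn : a * w0 + b * w1 + c * w2 = 0.
  transitivity (z * s * (a ^+ 2 + b ^+ 2 + c ^+ 2 - 1)); last by rewrite n1; ring.
  by rewrite /w0 /w1 /w2 /s; ring.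
have wth : w0 * th0 + w1 * th1 + w2 * th2 = 0.
  transitivity (- (x0 * (b * th2 - c * th1) + x1 * (c * th0 - a * th2)
    + x2 * (a * th1 - b * th0)) - z * (th0 * x0 + th1 * x1 + th2 * x2)
    + z * s * (a * th0 + b * th1 + c * th2)); first by rewrite /w0 /w1 /w2; ring.
  rewrite f0 f1 f2 thn thx.
  transitivity (- z * (th0 * x0 + th1 * x1 + th2 * x2)); first by ring.
  by rewrite thx mulr0.
have [l [l0 l1 l2]] : exists l, [/\ w0 = l * th0, w1 = l * th1 & w2 = l * th2].
  apply: cross_eigen_collinear; apply: (mulfI z0).
  - apply/eqP; rewrite -subr_eq0; apply/eqP.
    transitivity (w0 * (z * th1) - w1 * (z * th0)); first by ring.
    rewrite -f0 -f1.
    transitivity (c * (w0 * th0 + w1 * th1 + w2 * th2) - th2 * (a * w0 + b * w1 + c * w2)).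
      by ring.
    by rewrite wn wth !mulr0 subrr.
  - apply/eqP; rewrite -subr_eq0; apply/eqP.
    transitivity (w1 * (z * th2) - w2 * (z * th1)); first by ring.
    rewrite -f2 -f1.
    transitivity (a * (w0 * th0 + w1 * th1 + w2 * th2) - th0 * (a * w0 + b * w1 + c * w2)).
      by ring.
    by rewrite wn wth !mulr0 subrr.
  - apply/eqP; rewrite -subr_eq0; apply/eqP.
    transitivity (w2 * (z * th0) - w0 * (z * th2)); first by ring.
    rewrite -f2 -f0.
    transitivity (b * (w0 * th0 + w1 * th1 + w2 * th2) - th1 * (a * w0 + b * w1 + c * w2)).
      by ring.
    by rewrite wn wth !mulr0 subrr.
have w_eigen : [/\ b * w2 - c * w1 = - (z * w0), c * w0 - a * w2 = - (z * w1) &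
                   a * w1 - b * w0 = - (z * w2)].
  split; apply/eqP; rewrite -subr_eq0 opprK; apply/eqP.
  - transitivity (- x0 * (a ^+ 2 + b ^+ 2 + c ^+ 2 - 1) - (z ^+ 2 + 1) * (x0 - s * a)).
      by rewrite /w0 /w1 /w2 /s; ring.
    by rewrite n1 z2; ring.
  - transitivity (- x1 * (a ^+ 2 + b ^+ 2 + c ^+ 2 - 1) - (z ^+ 2 + 1) * (x1 - s * b)).
      by rewrite /w0 /w1 /w2 /s; ring.
    by rewrite n1 z2; ring.
  - transitivity (- x2 * (a ^+ 2 + b ^+ 2 + c ^+ 2 - 1) - (z ^+ 2 + 1) * (x2 - s * c)).
      by rewrite /w0 /w1 /w2 /s; ring.
    by rewrite n1 z2; ring.
have double (v : K) : z * v = - (z * v) -> v = 0.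
  move=> /eqP; rewrite -subr_eq0 opprK -mulr2n -mulr_natl mulrA mulf_eq0.
  by rewrite (negbTE z20) => /eqP.
have [w00 w10 w20] : [/\ w0 = 0, w1 = 0 & w2 = 0].
  case: w_eigen => e0 e1 e2; split; apply: double.
  - by rewrite -e0 l0 l1 l2 [z * _]mulrCA -f0; ring.
  - by rewrite -e1 l0 l1 l2 [z * _]mulrCA -f1; ring.
  - by rewrite -e2 l0 l1 l2 [z * _]mulrCA -f2; ring.
split; rewrite et -/s.
- by rewrite mulrA -expr2 z2 mulN1r.
- by transitivity (w0 + z * x0); [rewrite /w0; ring|rewrite w00 add0r].
- by transitivity (w1 + z * x1); [rewrite /w1; ring|rewrite w10 add0r].
- by transitivity (w2 + z * x2); [rewrite /w2; ring|rewrite w20 add0r].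
Qed.

(** The part of the eigenbundle in the line spanned by [E_3, e^0, e^1, e^2]:
    adding [z s n] to [y] turns the quaternionic equations into the cross product
    eigenvector equation, whose solutions are the multiples of [theta]. *)
Lemma left_eigen_covectorP s y0 y1 y2 :
  left_eigen z a b c s y0 y1 y2 <->
  exists l, [/\ y0 + z * s * a = l * th0, y1 + z * s * b = l * th1 &
                y2 + z * s * c = l * th2].
Proof.
case: (th) => f0 f1 f2; split=> [[es e0 e1 e2]|[l [l0 l1 l2]]].
  have zzs r : z * (z * s * r) = - (s * r).
    by rewrite !mulrA -expr2 z2 mulN1r mulNr.
  apply: cross_eigen_unique; split; rewrite [z * (_ + _)]mulrDr zzs.
  - by rewrite -e0; ring.
  - by rewrite -e1; ring.
  - by rewrite -e2; ring.
have y0E : y0 = l * th0 - z * s * a by rewrite -l0 addrK.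
have y1E : y1 = l * th1 - z * s * b by rewrite -l1 addrK.
have y2E : y2 = l * th2 - z * s * c by rewrite -l2 addrK.
have zzs r : z * (z * s * r) = - (s * r).
  by rewrite !mulrA -expr2 z2 mulN1r mulNr.
rewrite y0E y1E y2E; split; rewrite ?mulrBr ?zzs ?[z * (l * _)]mulrCA.
- transitivity (z * s * (a ^+ 2 + b ^+ 2 + c ^+ 2) - l * (a * th0 + b * th1 + c * th2)).
    by ring.
  by rewrite n1 thn mulr0 subr0 mulr1.
- by rewrite -f0; ring.
- by rewrite -f1; ring.
- by rewrite -f2; ring.
Qed.

End CrossEigenvectors.

Section TypeOne.
Context {R : realType}.
Local Notation C := R[i]%C.
Local Notation z := ('i%C : C).

(** The projection on the eigenspace sends a real vector [m] to a multiple of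
    [m - (n . m) n - i n x m]. Take [m = (1, 0, 0)] unless it is proportional to
    [n], and then [m = (0, 1, 0)]. *)
Lemma exists_cross_eigen (a b c : R) : a ^+ 2 + b ^+ 2 + c ^+ 2 = 1 ->
  exists th0 th1 th2 : C,
    cross_eigen a%:C%C b%:C%C c%:C%C z th0 th1 th2 /\
    [|| th0 != 0, th1 != 0 | th2 != 0].
Proof.
move=> abc; have abcC : a%:C%C ^+ 2 + b%:C%C ^+ 2 + c%:C%C ^+ 2 = 1 :> C.
  by rewrite -!rmorphXn -!rmorphD abc rmorph1.
have z2 := sqr_i R.
have [a1|a1] := eqVneq (a ^+ 2) 1.
  have [b0 c0] : b = 0 /\ c = 0.
    have /eqP : b ^+ 2 + c ^+ 2 = 0 by rewrite -[RHS](subrr 1) -{1}abc a1; ring.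
    by rewrite paddr_eq0 ?sqr_ge0 // !sqrf_eq0 => /andP[/eqP -> /eqP ->].
  exists 0, 1, (- z * a%:C%C); rewrite oner_eq0 orbT; split=> //.
  rewrite b0 c0 !rmorph0; split; rewrite ?mul0r ?mulr0 ?subrr //.
    rewrite sub0r mulr1 mulrCA -expr2 -rmorphXn a1 rmorph1 mulr1.
    by rewrite opprK.
  by rewrite subr0 mulr1 mulNr mulrN mulrA -expr2 z2 mulN1r opprK.
set a' := a%:C%C; set b' := b%:C%C; set c' := c%:C%C.
exists (1 - a' ^+ 2), (- (a' * b') - z * c'), (- (a' * c') + z * b').
split; last first.
  by rewrite subr_eq0 eq_sym -rmorphXn -(rmorph1 (real_complex R)) (inj_eq (@complexI R)) a1.
have zz (r : C) : z * (z * r) = - r by rewrite mulrA -expr2 z2 mulN1r.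
have n2 : 1 - a' ^+ 2 = b' ^+ 2 + c' ^+ 2 by rewrite -abcC; ring.
split.
- by rewrite n2; ring.
- by rewrite [z * (_ - _)]mulrBr zz; ring.
- by rewrite [z * (_ + _)]mulrDr zz; ring.
Qed.

Lemma form2Z (k : C) n (b : 'M[C]_n) : form2 (k *: b) = k *: form2 b.
Proof.
apply/ffunP => A; rewrite !ffunE scaler_sumr.
by apply: eq_bigr => ij _; rewrite mxE.
Qed.

(** A decomposable 2-form has square zero. *)
Lemma form_exp_decomposable n (k : C) (alpha beta : 'cV[C]_n.+1) :
  form_exp (k *: wedge (form1 alpha) (form1 beta))
  = form_one + k *: wedge (form1 alpha) (form1 beta).
Proof.
set b := k *: _.
have bb : wedge b (wedge b form_one) = 0.
  rewrite wedge1r /b wedgeZl wedgeZr -wedgeA (wedge_form1_anticomm beta alpha).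
  have self : wedge (form1 beta) (form1 beta) = 0.
    by rewrite -[X in wedge _ X]wedge1r wedge_form1_sqr.
  by rewrite self wedge0r oppr0 wedge0r !scaler0.
have high m : iter m.+2 (wedge b) form_one = 0.
  by rewrite 2!iterSr bb; elim: m => //= m ->; rewrite wedge0r.
rewrite /form_exp 2!big_ord_recl big1 => [|i _].
  by rewrite /= !invr1 !scale1r addr0 wedge1r.
by rewrite (_ : iter _ _ _ = 0) ?scaler0 //; exact: high i.
Qed.

(** The spinor is [e^(i omega) theta] with [omega = - n /\ e^3] and [theta] a
    complex combination of [e^0, e^1, e^2] with [n x theta = i theta]: a complex
    structure in the plane orthogonal to [n], a symplectic form on the plane of
    [n] and [e^3]. Its annihilator, computed by [clifford_eq0], splits along the
    two quaternionic lines into the eigenspaces found above. *)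
Theorem kt_quat_type1 (a b c t : R) : a ^+ 2 + b ^+ 2 + c ^+ 2 = 1 ->
  has_type (kt_quat a b c t) 1.
Proof.
move=> abc.
have abcC : a%:C%C ^+ 2 + b%:C%C ^+ 2 + c%:C%C ^+ 2 = 1 :> C.
  by rewrite -!rmorphXn -!rmorphD abc rmorph1.
have [th0 [th1 [th2 [th nz]]]] := exists_cross_eigen abc.
pose col4 (K : pzRingType) (x0 x1 x2 x3 : K) : 'cV[K]_4 :=
  \col_i nth 0 [:: x0; x1; x2; x3] i.
pose alpha := col4 R a b c 0.
pose beta := col4 R 0 0 (- t) 1.
pose theta := col4 C th0 th1 th2 0.
pose w := beta *m alpha^T - alpha *m beta^T.
have theta0 : theta != 0.
  by apply/negP => /eqP/colP e; move: nz; have := (e 0, e 1, e 2);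
    rewrite !mxE /= => -[[-> ->] ->]; rewrite eqxx.
exists 0, w, (form1 theta); split.
- by split=> [|i]; rewrite ?trmx0 ?oppr0 // mxE.
- split=> [|i]; first by rewrite /w linearB /= !trmx_mul !trmxK opprB.
  by rewrite !mxE !big_ord1 !mxE mulrC subrr.
- split; first by rewrite form1_eq0.
  by exists 1, (fun=> theta); rewrite scale1r big_ord_recl big_ord0 wedge1r.
have -> : form2 (cmx 0 + z *: cmx w)
  = - z *: wedge (form1 (cmx alpha)) (form1 (cmx beta)).
  rewrite -form2_wedge -form2Z; congr form2.
  rewrite /cmx map_mx0 add0r map_mxB !map_mxM /= -!map_trmx.
  by rewrite scaleNr -scalerN opprB.
rewrite form_exp_decomposable => u; rewrite -[u]vsubmxK.
move: (usubmx u) (dsubmx u) => x xi {u}.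
apply: (iff_trans _ (iff_sym (clifford_eq0 _ _ _ _ _ theta0))).
apply: (iff_trans (eigenL_colP _ _ _ _ _ _)).
have z2 := sqr_i R.
rewrite (left_eigen_vectorP z2 abcC th nz) (left_eigen_covectorP z2 abcC th nz).
have -> : \sum_i theta i 0 * x i 0 = th0 * x 0 0 + th1 * x 1 0 + th2 * x 2 0.
  by rewrite sum_ord4 !mxE /= mul0r addr0.
set nx := a%:C%C * x 0 0 + b%:C%C * x 1 0 + c%:C%C * x 2 0.
have -> : \sum_i cmx alpha i 0 * x i 0 = nx.
  by rewrite sum_ord4 !mxE /= rmorph0 mul0r addr0.
set s := x 3 0 - t%:C%C * x 2 0.
have -> : \sum_i cmx beta i 0 * x i 0 = s.
  rewrite sum_ord4 !mxE /= rmorph0 rmorph1 rmorphN !mul0r mul1r !add0r.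
  by rewrite mulNr addrC.
split=> [[[thx xi3] [l [l0 l1 l2]]]|[thx [l /colP E]]].
  split=> //; exists l; apply/colP; elim/ord4_ind; rewrite !mxE /=.
  - by rewrite -l0; ring.
  - by rewrite -l1; ring.
  - by rewrite -l2 xi3 rmorphN; ring.
  - by rewrite xi3; ring.
have xi3 : xi 3 0 = z * nx.
  have := E 3; rewrite !mxE /=.
  rewrite rmorph0 rmorph1 !mulr0 mulr1 subr0 mulNr => /eqP.
  by rewrite subr_eq0 => /eqP.
split=> //; exists l.
have := E 0; have := E 1; have := E 2; rewrite !mxE /= => <- <- <-.
by split; rewrite ?xi3 ?rmorphN; ring.
Qed.

End TypeOne.

(** * The holomorphic symplectic structure *)

Section ComplexMatrices.
Context {K : comNzRingType}.
Implicit Types (t : K).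

(** The complex structure with [J E_0 = E_3] and [J E_1 = E_2], in coordinates
    at a point with [x_1 = t]. *)
Definition kt_J t : 'M[K]_4 :=
  mx4 [:: [:: 0; 0; t; - 1]; [:: 0; 0; - 1; 0]; [:: 0; 1; 0; 0]; [:: 1; t; 0; 0]].

(** The differential of [kt_chart] at a point with [x_1 = t]. *)
Definition chart_mx t : 'M[K]_4 :=
  mx4 [:: [:: 0; 1; 0; 0]; [:: 1; t; 0; 0]; [:: 0; 0; 1; 0]; [:: 0; 0; 0; 1]].

Definition std_mx : 'M[K]_4 :=
  mx4 [:: [:: 0; 0; - 1; 0]; [:: 0; 0; 0; - 1]; [:: 1; 0; 0; 0]; [:: 0; 1; 0; 0]].

Lemma frame_mx4 t : frame t =
  mx4 [:: [:: 1; 0; 0; 0]; [:: 0; 1; 0; 0]; [:: 0; 0; 1; 0]; [:: 0; 0; t; 1]].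
Proof. mx4_ring. Qed.

Lemma kt_J_sqr t : kt_J t *m kt_J t = - 1%:M.
Proof. mx4_ring. Qed.

Lemma kt_J_shift s t : kt_J (s + t) *m frame s = frame s *m kt_J t.
Proof.
by rewrite frame_mx4; mx4_ring.
Qed.

Lemma chart_mx_kt_J t : chart_mx t *m kt_J t = std_mx *m chart_mx t.
Proof. mx4_ring. Qed.

Lemma kt_J_eigenP l t (u : 'cV[K]_4) : kt_J t *m u = l *: u <->
  [/\ t * u 2 0 - u 3 0 = l * u 0 0, - u 2 0 = l * u 1 0, u 1 0 = l * u 2 0 &
      u 0 0 + t * u 1 0 = l * u 3 0].
Proof.
have E : kt_J t *m u = \col_i nth 0 [:: t * u 2 0 - u 3 0; - u 2 0; u 1 0;
                                        u 0 0 + t * u 1 0] i.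
  apply/colP; elim/ord4_ind; rewrite ?(mxE, sum_ord4) /=; ring.
rewrite E; split=> [/colP e|[e0 e1 e2 e3]].
  by have := (e 0, e 1, e 2, e 3); rewrite !mxE /= => -[[[]]].
by apply/colP; elim/ord4_ind; rewrite !mxE.
Qed.

(** The (1,0)-forms [e^1 + z e^2] and [e^0 + z e^3], for [z] a square root of -1.
    The second one differs from the differential of the holomorphic coordinate
    by [x_1] times the first. *)
Definition dz (z : K) (u : 'cV[K]_4) : K := u 1 0 + z * u 2 0.

Definition dw (z t : K) (u : 'cV[K]_4) : K := u 0 0 + z * (u 3 0 - t * u 2 0).

(** The product of [dz] and [dw], see [kt_formE]. *)
Definition kt_form (z t : K) : 'M[K]_4 :=
  mx4 [:: [:: 0; - 1; - z; 0]; [:: 1; 0; - (z * t); z]; [:: z; z * t; 0; z ^+ 2];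
          [:: 0; - z; - z ^+ 2; 0]].

Definition kt_form_slope (z : K) : 'M[K]_4 :=
  mx4 [:: [::]; [:: 0; 0; - z; 0]; [:: 0; z; 0; 0]].

Lemma kt_form_affine z t i j :
  kt_form z t i j = kt_form z 0 i j + t * kt_form_slope z i j.
Proof. by elim/ord4_ind: i; elim/ord4_ind: j; rewrite !mxE /=; ring. Qed.

Lemma kt_formE z t u v :
  u^T *m kt_form z t *m v = (dz z u * dw z t v - dw z t u * dz z v)%:M.
Proof.
apply/matrixP => i j; rewrite !ord1 ?(mxE, sum_ord4) /= /dz /dw; ring.
Qed.

Lemma kt_form_shift z s t :
  (frame s)^T *m kt_form z (s + t) *m frame s = kt_form z t.
Proof.
have entry (A : 'M[K]_4) i j :
    A i j = ((delta_mx i 0 : 'cV_4)^T *m A *m (delta_mx j 0 : 'cV_4)) 0 0.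
  by rewrite trmx_delta -rowE -colE !mxE.
have dz_frame u : dz z (frame s *m u) = dz z u.
  by rewrite /dz frame_mx4 ?(mxE, sum_ord4) /=; ring.
have dw_frame u : dw z (s + t) (frame s *m u) = dw z t u.
  by rewrite /dw frame_mx4 ?(mxE, sum_ord4) /=; ring.
apply/matrixP => i j; rewrite [LHS]entry [RHS]entry kt_formE.
rewrite -(dz_frame (delta_mx i 0)) -(dw_frame (delta_mx i 0)).
rewrite -(dz_frame (delta_mx j 0)) -(dw_frame (delta_mx j 0)) -kt_formE.
by rewrite trmx_mul !mulmxA.
Qed.

Lemma tr_kt_form z t : (kt_form z t)^T = - kt_form z t.
Proof. mx4_ring. Qed.

End ComplexMatrices.

Section HolomorphicSymplectic.
Context {R : realType}.
Local Notation C := R[i]%C.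
Implicit Types (p q : 'cV[R]_4).

(** Real parts, then imaginary parts, of the holomorphic coordinates
    [x_1 + i x_2] and [x_0 + x_1^2 / 2 + i x_3]. The quadratic term makes the
    second differential of type (1,0): it is [e^0 + i e^3 + x_1 (e^1 + i e^2)]. *)
Definition kt_chart p : 'cV[R]_4 :=
  \col_i nth 0 [:: p 1 0; p 0 0 + 2^-1 * (p 1 0 * p 1 0); p 2 0; p 3 0] i.

Definition kt_chart_inv q : 'cV[R]_4 :=
  \col_i nth 0 [:: q 1 0 - 2^-1 * (q 0 0 * q 0 0); q 0 0; q 2 0; q 3 0] i.

Lemma smooth_kt_chart : smooth_mx setT kt_chart.
Proof.
move=> i j; rewrite ord1; elim/ord4_ind: i; under eq_fun do rewrite mxE /=;
  try exact: smooth_entry.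
apply: smoothD; first exact: smooth_entry.
by apply: smoothM; [exact: smooth_cst|apply: smoothM; exact: smooth_entry].
Qed.

Lemma smooth_kt_chart_inv : smooth_mx setT kt_chart_inv.
Proof.
move=> i j; rewrite ord1; elim/ord4_ind: i; under eq_fun do rewrite mxE /=;
  try exact: smooth_entry.
apply: smoothD; first exact: smooth_entry.
apply: smooth_opp.
by apply: smoothM; [exact: smooth_cst|apply: smoothM; exact: smooth_entry].
Qed.

Lemma kt_chartK : cancel kt_chart kt_chart_inv.
Proof. by move=> p; apply/colP; elim/ord4_ind; rewrite !mxE /= ?addrK. Qed.

Lemma kt_chart_invK : cancel kt_chart_inv kt_chart.
Proof. by move=> p; apply/colP; elim/ord4_ind; rewrite !mxE /= ?subrK. Qed.

Lemma jac_kt_chart p : jac kt_chart p = chart_mx (p 1 0).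
Proof.
have dx k : differentiable (fun q : 'cV[R]_4 => q k 0) p.
  exact: differentiable_entry.
apply/matrixP => i j; rewrite mxE mxE.
elim/ord4_ind: i; under eq_fun do rewrite mxE /=; rewrite ?partial_entry;
  try by elim/ord4_ind: j.
rewrite partialD //; last first.
  by apply: differentiableM; [exact: differentiable_cst|exact: differentiableM].
rewrite partialM //; last exact: differentiableM.
rewrite partial_cst partialM // !partial_entry.
by elim/ord4_ind: j => /=; field.
Qed.

Lemma std_complexE : @std_complex R 2 = std_mx.
Proof.
rewrite -[RHS](@submxK R 2 2 2 2) /std_complex.
by congr block_mx; apply/matrixP => -[[|[|//]] ?] -[[|[|//]] ?];
  rewrite !mxE /= ?oppr0.
Qed.

Lemma kt_J_complex : @complex_structure R 2 (fun p => kt_J (p 1 0)).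
Proof.
split.
- by elim/ord4_ind; elim/ord4_ind; under eq_fun do rewrite mxE /=;
    first [exact: smooth_cst|exact: smooth_entry].
- by move=> p; apply: kt_J_sqr.
- move=> p; exists setT, kt_chart; split=> //.
  exists setT, kt_chart_inv; split.
    split; [exact: openT|exact: openT|exact: smooth_kt_chart|exact: smooth_kt_chart_inv].
  split=> // q _; [exact: kt_chartK|exact: kt_chart_invK|].
  by rewrite jac_kt_chart std_complexE; apply: chart_mx_kt_J.
Qed.

Lemma map_kt_J t : cmx (kt_J t) = kt_J t%:C%C :> 'M[C]_4.
Proof.
by apply/matrixP; elim/ord4_ind; elim/ord4_ind;
  rewrite !mxE /= ?rmorphN ?rmorph0 ?rmorph1.
Qed.

Local Notation z := ('i%C : C).
Local Notation sigma := (fun p : 'cV[R]_4 => kt_form z (p 1 0)%:C%C).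

Lemma csmooth_kt_form : csmooth_mx setT sigma.
Proof.
have ReZ (x : R) (d : C) : complex.Re (x%:C%C * d) = x * complex.Re d.
  by rewrite ReM /= mul0r subr0.
have ImZ (x : R) (d : C) : complex.Im (x%:C%C * d) = x * complex.Im d.
  by rewrite ImM /= mul0r addr0.
move=> i j; split; under eq_fun do rewrite kt_form_affine.
  under eq_fun do rewrite ReD ReZ.
  apply: smoothD; first exact: smooth_cst.
  by apply: smoothM; [exact: smooth_entry|exact: smooth_cst].
under eq_fun do rewrite ImD ImZ.
apply: smoothD; first exact: smooth_cst.
by apply: smoothM; [exact: smooth_entry|exact: smooth_cst].
Qed.

Lemma cpartial_kt_form (i j k : 'I_4) p :
  cpartial i (fun q => sigma q j k) p = (1 == i)%:R * kt_form_slope z j k.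
Proof.
under eq_fun do rewrite kt_form_affine.
have dx : cdifferentiable (fun q : 'cV[R]_4 => (q 1 0)%:C%C) p.
  exact/cdifferentiable_real/differentiable_entry.
have dc (c : C) : cdifferentiable (fun _ : 'cV[R]_4 => c) p.
  exact: cdifferentiable_cst.
rewrite cpartialD //; last exact: cdifferentiableM.
rewrite cpartialM // !cpartial_cst cpartial_real partial_entry mulr0 addr0 add0r.
by rewrite rmorph_nat.
Qed.

(** Only the component along [dx_1 /\ dx_2] varies, and it depends on [x_1]
    alone. *)
Lemma closed_kt_form : @closed2 R 2 sigma.
Proof.
move=> p i j k; rewrite !cpartial_kt_form.
by elim/ord4_ind: i; elim/ord4_ind: j; elim/ord4_ind: k; rewrite !mxE /=; ring.
Qed.

Theorem kt_holomorphic_symplectic Gam :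
  KT_holomorphic_symplectic Gam (fun p => kt_J (p 1 0)) sigma.
Proof.
have z2 := sqr_i R.
have zz : z * z = -1 by rewrite -expr2.
split.
- by move=> g p _; rewrite jac_kt_mul kt_mul1; apply: kt_J_shift.
- move=> g p _; rewrite jac_kt_mul kt_mul1 map_frame rmorphD.
  exact: kt_form_shift.
split; first exact: kt_J_complex.
- split; first exact: csmooth_kt_form.
  move=> p; split; first exact: tr_kt_form.
  by elim/ord4_ind; rewrite mxE.
- move=> p u; rewrite map_kt_J => /kt_J_eigenP[e0 e1 e2 e3] v.
  rewrite kt_formE.
  have -> : dz z u = 0.
    by rewrite /dz e2 mulNr addNr.
  have -> : dw z (p 1 0)%:C%C u = 0.
    by rewrite /dw -opprB e0 mulNr opprK mulrA -expr2 z2 mulN1r subrr.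
  by rewrite !mul0r subrr raddf0.
- exact: closed_kt_form.
- move=> p u; rewrite map_kt_J; set t := (p 1 0)%:C%C.
  move=> /kt_J_eigenP[e0 e1 e2 e3] nondeg.
  (* The (1,0)-vectors dual to dz and dw, up to a factor 2. *)
  pose v1 : 'cV[C]_4 := \col_i nth 0 [:: 0; 1; - z; - z * t] i.
  pose v2 : 'cV[C]_4 := \col_i nth 0 [:: 1; 0; 0; - z] i.
  have ev1 : kt_J t *m v1 = z *: v1.
    apply/kt_J_eigenP; rewrite !mxE /=; split; rewrite ?mulrA ?mulrN ?mulNr ?zz; ring.
  have ev2 : kt_J t *m v2 = z *: v2.
    apply/kt_J_eigenP; rewrite !mxE /=; split; rewrite ?mulrA ?mulrN ?mulNr ?zz; ring.
  have scal0 (c : C) : c%:M = 0 :> 'M[C]_1 -> c = 0.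
    by move/matrixP/(_ 0 0); rewrite !mxE.
  have dz1 : dz z v1 = 2 by rewrite /dz !mxE /= mulrN zz opprK.
  have dw1 : dw z t v1 = 0 by rewrite /dw !mxE /=; ring.
  have dz2 : dz z v2 = 0 by rewrite /dz !mxE /=; ring.
  have dw2 : dw z t v2 = 2 by rewrite /dw !mxE /= mulr0 subr0 mulrN zz opprK.
  have two0 : 2 != 0 :> C by rewrite pnatr_eq0.
  have double0 (c : C) : c + c = 0 -> c = 0.
    by move/eqP; rewrite -mulr2n mulrn_eq0 => /eqP.
  have dzu : dz z u = 0.
    have := nondeg v2 ev2; rewrite kt_formE dz2 dw2 mulr0 subr0 => /scal0/eqP.
    by rewrite mulf_eq0 (negbTE two0) orbF => /eqP.
  have dwu : dw z t u = 0.
    have := nondeg v1 ev1; rewrite kt_formE dz1 dw1 mulr0 sub0r => /scal0/eqP.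
    by rewrite oppr_eq0 mulf_eq0 (negbTE two0) orbF => /eqP.
  have u1 : u 1 0 = 0 by apply: double0; rewrite {2}e2.
  have u2 : u 2 0 = 0 by apply/eqP; rewrite -oppr_eq0 e1 u1 mulr0.
  have u0 : u 0 0 = 0.
    by apply: double0; move: dwu; rewrite /dw -opprB e0 mulrN mulrA zz mulN1r opprK.
  have u3 : u 3 0 = 0.
    by move/eqP: e0; rewrite u2 u0 !mulr0 sub0r oppr_eq0 => /eqP.
  suff: (u : 'cV[C]_4) = 0 by [].
  by apply/colP; elim/ord4_ind; rewrite [RHS]mxE.
Qed.

End HolomorphicSymplectic.

(** * The theorem *)

Theorem proposition5p3 (R : realType) (Gam : set 'cV[R]_4)
    (hGam : lattice Gam) :
  (exists (J : 'cV[R]_4 -> 'M[R]_4) (s : 'cV[R]_4 -> 'M[R[i]%C]_4),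
      KT_holomorphic_symplectic Gam J s) /\
  (exists I J K : 'cV[R]_4 -> 'M[R]_(4 + 4),
      KT_generalized_hypercomplex Gam I J K /\
      forall a b c : R, a ^+ 2 + b ^+ 2 + c ^+ 2 = 1 ->
        forall p : 'cV[R]_4, has_type (sphere_member I J K a b c p) 1).
Proof.
split; first by do 2!eexists; exact: kt_holomorphic_symplectic.
do 3!eexists; split; first exact: kt_quat_hypercomplex.
by move=> a b c abc p; rewrite /sphere_member kt_quat_lin; exact: kt_quat_type1.
Qed.
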